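(* For every $\eta>1$ there is a constant $c'_\eta>0$, and there are numerical constants $c_1,c_2>0$, such that the following holds in the Gaussian $G$-latent setting below with all groups of equal size $m=p/K\ge3$ and $C$ positive definite. For any $0<\rho<1$, if $$\lambda_K(C)\ge\frac{c'_\eta\sqrt K\,\|\Sigma\|_{op}}{m\sqrt\rho}\sqrt{\frac{Re(\Sigma)\vee\log p}{n}},$$ then with probability at least $1-c_2/p$ the partition $\widehat G$ produced by the CSC algorithm satisfies $\overline L(\widehat G,G)\le\rho$.
   Context: Setting: $G=\{G_1,\dots,G_K\}$ is a partition of $[p]$, $|G_k|=m$ for all $k$, $k(a)$ the index with $a\in G_{k(a)}$. $X$ satisfies $X_a=Z_{k(a)}+E_a$, with $Z\sim N(0,C)$ in $\mathbb{R}^K$, $E\sim N(0,\Gamma)$ in $\mathbb{R}^p$ independent, $\Gamma$ diagonal with $\Gamma_{aa}=\gamma_{k(a)}>0$; $\Sigma=ACA^t+\Gamma$, $A_{ak}=1_{\{a\in G_k\}}$. Data: $n$ i.i.d. copies of $X$ as rows of the $n\times p$ matrix $\mathbf{X}$; $\widehat\Sigma=\mathbf{X}^t\mathbf{X}/n$. $\lambda_K(C)$ is the smallest eigenvalue of $C$; $Re(\Sigma)=\mathrm{tr}(\Sigma)/\|\Sigma\|_{op}$. $\widehat\Gamma$: with $V(a,b)=\max_{c,d\in[p]\setminus\{a,b\}}\big|\langle\mathbf{X}_{:a}-\mathbf{X}_{:b},\frac{\mathbf{X}_{:c}-\mathbf{X}_{:d}}{|\mathbf{X}_{:c}-\mathbf{X}_{:d}|_2}\rangle\big|$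 ($0/0=0$), $ne_1(a)\in\arg\min_{b\neq a}V(a,b)$, $ne_2(a)\in\arg\min_{b\notin\{a,ne_1(a)\}}V(a,b)$, $\widehat\Gamma$ is diagonal with $\widehat\Gamma_{aa}=\frac1n\langle\mathbf{X}_{:a}-\mathbf{X}_{:ne_1(a)},\mathbf{X}_{:a}-\mathbf{X}_{:ne_2(a)}\rangle$. CSC algorithm: let $\widehat U$ be the $p\times K$ matrix of orthonormal eigenvectors of $\widehat\Sigma-\widehat\Gamma$ for its $K$ largest eigenvalues; let $\mathcal{A}_{p,K}$ be the set of $p\times K$ binary matrices with exactly one nonzero entry per row (each defines a partition of $[p]$ into at most $K$ groups); choose $\widehat A\in\mathcal{A}_{p,K}$ and $\widehat Q\in\mathbb{R}^{K\times K}$ with $\|\widehat U-\widehat A\widehat Q\|_F^2\le\eta\min_{A\in\mathcal{A}_{p,K}}\min_{Q}\|\widehat U-AQ\|_F^2$ (an $\eta$-approximate $K$-means), and let $\widehat G$ be the partition encoded by $\widehat A$. Loss: $\overline L(\widehat G,G)=\min_{\sigma\in\mathcal{S}_K}\sum_{k=1}^K|G_k\setminus\widehat G_{\sigma(k)}|/m$, $\mathcal{S}_K$ the permutations of $[K]$. *)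

(* Defs.v *)
From HB Require Import structures.
From mathcomp Require Import all_boot all_order all_algebra fingroup perm.
From mathcomp Require Import all_classical all_reals all_analysis.
Set Implicit Arguments. Unset Strict Implicit. Unset Printing Implicit Defensive.
Import Order.TTheory GRing.Theory Num.Theory.
Local Open Scope classical_set_scope.
Local Open Scope ring_scope.

Section Defs.
Variable R : realType.

(* membership matrix of a labelling lab : [p] -> [K] : A_{ak} = 1_{lab a = k};
   these are exactly the binary p x K matrices with one nonzero entry per row *)
Definition memb (p K : nat) (lab : 'I_p -> 'I_K) : 'M[R]_(p, K) :=
  \matrix_(a, k) ((lab a == k)%:R).

Definition SigmaMod (p K : nat) (kG : 'I_p -> 'I_K) (C : 'M[R]_K)
  (gam : 'I_K -> R) : 'M[R]_p :=
  memb kG *m C *m (memb kG)^T + diag_mx (\row_a gam (kG a)).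

Definition vnorm (q : nat) (x : 'cV[R]_q) : R := Num.sqrt (\sum_i (x i 0) ^+ 2).

Definition opnorm (q r : nat) (M : 'M[R]_(q, r)) : R :=
  sup [set vnorm (M *m x) | x in [set x : 'cV[R]_r | vnorm x = 1]].

Definition effrank (q : nat) (S : 'M[R]_q) : R := \tr S / opnorm S.

Definition lambda_min (q : nat) (M : 'M[R]_q) : R := inf [set a : R | eigenvalue M a].

Definition posdef (q : nat) (M : 'M[R]_q) : Prop :=
  M^T = M /\ forall x : 'rV[R]_q, x != 0 -> 0 < (x *m M *m x^T) 0 0.

Definition frob2 (q r : nat) (M : 'M[R]_(q, r)) : R := \sum_i \sum_j (M i j) ^+ 2.

Definition Sighat (n p : nat) (X : 'M[R]_(n, p)) : 'M[R]_p := (n%:R)^-1 *: (X^T *m X).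

(* V(a,b); division by 0 gives 0 in MathComp (0/0 = 0 convention) *)
Definition Vab (n p : nat) (X : 'M[R]_(n, p)) (a b : 'I_p) : R :=
  \big[Num.max/0]_(c | (c != a) && (c != b))
   \big[Num.max/0]_(d | (d != a) && (d != b))
     `| \sum_i (X i a - X i b) *
          ((X i c - X i d) / Num.sqrt (\sum_j (X j c - X j d) ^+ 2)) |.

Definition valid_ne (n p : nat) (X : 'M[R]_(n, p)) (ne1 ne2 : 'I_p -> 'I_p) : Prop :=
  forall a : 'I_p,
    [/\ ne1 a != a, (forall b, b != a -> Vab X a (ne1 a) <= Vab X a b),
        ne2 a != a, ne2 a != ne1 a &
        (forall b, b != a -> b != ne1 a -> Vab X a (ne2 a) <= Vab X a b)].

Definition Gamhat (n p : nat) (X : 'M[R]_(n, p)) (ne1 ne2 : 'I_p -> 'I_p) : 'M[R]_p :=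
  diag_mx (\row_a ((n%:R)^-1 * \sum_i (X i a - X i (ne1 a)) * (X i a - X i (ne2 a)))).

Definition top_eigvecs (p K : nat) (M : 'M[R]_p) (U : 'M[R]_(p, K)) : Prop :=
  exists (O : 'M[R]_p) (mu : 'I_p -> R),
    [/\ O^T *m O = 1%:M, M *m O = O *m diag_mx (\row_j mu j),
        (forall i j : 'I_p, (i <= j)%N -> mu j <= mu i) &
        (forall (a : 'I_p) (k : 'I_K) (j : 'I_p), val j = val k -> U a k = O a j)].

Definition approx_kmeans (p K : nat) (eta : R) (U : 'M[R]_(p, K))
  (lab : 'I_p -> 'I_K) (Q : 'M[R]_K) : Prop :=
  frob2 (U - memb lab *m Q) <=
  eta * inf [set r | exists (l : 'I_p -> 'I_K) (Q' : 'M[R]_K), r = frob2 (U - memb l *m Q')].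

Definition CSC_output (n p K : nat) (eta : R) (X : 'M[R]_(n, p)) (lab : 'I_p -> 'I_K) : Prop :=
  exists (ne1 ne2 : 'I_p -> 'I_p) (U : 'M[R]_(p, K)) (Q : 'M[R]_K),
    [/\ valid_ne X ne1 ne2, top_eigvecs (Sighat X - Gamhat X ne1 ne2) U &
        approx_kmeans eta U lab Q].

(* Lbar(Ghat, G), G_k = {a | kG a = k}, Ghat_k = {a | lab a = k} *)
Definition Lbar (p K m : nat) (lab kG : 'I_p -> 'I_K) : R :=
  inf [set r | exists s : {perm 'I_K},
      r = \sum_(k : 'I_K) (#|[pred a | (kG a == k) && (lab a != s k)]|%:R / m%:R)].

Context {d : measure_display} {T : measurableType d} (P : probability T R).

Definition centered_gaussian (I : finType) (Y : I -> T -> R) (S : I -> I -> R) : Prop :=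
  (forall i, measurable_fun setT (Y i)) /\
  forall u : I -> R, (exists i, u i != 0) ->
    forall B : set R, measurable B ->
      P [set w | B (\sum_i u i * Y i w)] =
      normal_prob 0 (Num.sqrt (\sum_i \sum_j u i * u j * S i j)) B.

Definition sigma_of (I : Type) (Y : I -> T -> R) : set (set T) :=
  <<s [set A | exists (j : I) (B : set R), measurable B /\ A = Y j @^-1` B] >>.

Definition mutually_indep (I : finType) (F : I -> set (set T)) : Prop :=
  forall (J : {set I}) (A : I -> set T), (forall i, i \in J -> F i (A i)) ->
    P (\big[setI/setT]_(i in J) A i) = (\prod_(i in J) P (A i))%E.

End Defs.

Definition data_matrix (R : realType) (T : Type) (n p K : nat) (kG : 'I_p -> 'I_K)
  (Z : 'I_n -> 'I_K -> T -> R) (E : 'I_n -> 'I_p -> T -> R) (w : T) : 'M[R]_(n, p) :=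
  \matrix_(i, a) (Z i (kG a) w + E i a w).

(* Main.v *)
Require Import Defs.
From HB Require Import structures.
From mathcomp Require Import all_boot all_order all_algebra fingroup perm.
From mathcomp Require Import all_classical all_reals all_analysis.
From mathcomp Require Import measurable_realfun.
From mathcomp Require Import ring lra.
Import Order.TTheory GRing.Theory Num.Theory.
Local Open Scope classical_set_scope.
Local Open Scope ring_scope.

(** Write [Mhat = A C A^T + Delta] with [Delta = Sighat - Gamhat - A C A^T]. The
    estimate rests on the dimension-free bound
    [opnorm Delta <= c * opnorm Sigma * sqrt (max Re (log p) / n)].

    All the probability needed is the exponential moment of [|X v|^2 - n v^T Sigma v]
    for finitely many fixed vectors [v], followed by one application of Markov's
    inequality to a weighted sum of such exponentials. The operator norm of
    [Sighat - Sigma] is then reached by a PAC-Bayes argument: a unit vector [x] is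
    (almost) the mean of [theta], the average of [N ~ max Re (log p)] independent
    vectors with biased random signs of mean [x]; the law of [theta] has relative
    entropy at most [N] with respect to unbiased signs, while
    [theta^T Sigma theta <= 128 * opnorm Sigma] outside an event of small
    probability. The diagonal [Gamhat] is controlled through the Gram matrix of the
    contrasts [X_a - X_b]. A Davis-Kahan argument bounds the distance of [U] to the
    range of [A], whose rows are well separated from one group to another, and a
    counting of the rows far from their center concludes. *)

Set Implicit Arguments. Unset Strict Implicit. Unset Printing Implicit Defensive.

(** * Integration against product laws *)

(** A net of the unit sphere would bring the dimension [p] into the bound; the relative entropy of
    the sign averages brings only [N]. Signs also take finitely many values, so the average over the
    prior is a finite sum. It shares one Markov inequality, at level [p], with the contrasts: each
    family has total weight 1, whence the numerical constant [2] in the probability. The factor [p]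
    is absorbed by [expR N], as [ln p <= N]. Only moments of quadratic forms are available, while
    the operator norm and the covariances of contrasts are bilinear: polarization goes from one to
    the other. The exponential of a Gaussian square is integrable only when exponent times variance
    is small, which forces the truncation of [theta]. The contrasts are normalised because the
    analysis of the neighbours needs errors relative to the variance of each contrast. A small
    sample size is not a separate case: [m * lambda_min C <= opnorm Sigma] turns the assumed lower
    bound on [lambda_min C] into an upper bound on [sqrt (N / n)]. *)

Section WeightedPushforward.
Local Open Scope ereal_scope.
Context d1 d2 (X : measurableType d1) (Y : measurableType d2) (R : realType).
Variables (mu : {measure set X -> \bar R}) (w : X -> R) (phi : X -> Y).
Hypotheses (mw : measurable_fun setT w) (w0 : forall x, (0 <= w x)%R).
Hypothesis mphi : measurable_fun setT phi.

Definition weighted_pushforward (D : set Y) : \bar R :=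
  \int[mu]_(x in phi @^-1` D) (w x)%:E.

Let mwE : measurable_fun setT (EFin \o w).
Proof. exact/measurable_EFinP. Qed.

Let mpre D : measurable D -> measurable (phi @^-1` D).
Proof. by move=> mD; rewrite -[_ @^-1` _]setTI; exact: mphi. Qed.

Lemma weighted_pushforward0 : weighted_pushforward set0 = 0.
Proof. by rewrite /weighted_pushforward preimage_set0 integral_set0. Qed.

Lemma weighted_pushforward_ge0 D : 0 <= weighted_pushforward D.
Proof. by apply: integral_ge0 => x _; rewrite lee_fin. Qed.

Lemma weighted_pushforward_sigma_additive :
  semi_sigma_additive weighted_pushforward.
Proof.
move=> F mF tF mUF; rewrite /weighted_pushforward preimage_bigcup.
rewrite ge0_integral_bigcup//.
- by apply: is_cvg_ereal_nneg_natsum_cond => n _ _; exact: weighted_pushforward_ge0.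
- by move=> k; apply: mpre.
- exact: measurable_funTS.
- by move=> x _; rewrite lee_fin.
- apply/trivIsetP => i j _ _ ij; rewrite -preimage_setI.
  by move/trivIsetP : tF => /(_ _ _ I I ij) ->; rewrite preimage_set0.
Qed.

HB.instance Definition _ := isMeasure.Build _ _ _ weighted_pushforward
  weighted_pushforward0 weighted_pushforward_ge0
  weighted_pushforward_sigma_additive.

Lemma weighted_pushforward_measure : exists nu : {measure set Y -> \bar R},
  forall D, nu D = \int[mu]_(x in phi @^-1` D) (w x)%:E.
Proof. by exists weighted_pushforward. Qed.

Import HBNNSimple.

(** Change of variables when the image under [phi] of the measure of density [w] is [c] times [m].
    For a simple function the assumption applies on each level set; monotone convergence on both
    sides does the rest. *)
Lemma ge0_integral_weighted (m : {measure set Y -> \bar R}) (c : {nonneg R})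
    (g : Y -> \bar R) :
  (forall D, measurable D ->
    \int[mu]_(x in phi @^-1` D) (w x)%:E = c%:num%:E * m D) ->
  measurable_fun setT g -> (forall y, 0 <= g y) ->
  \int[mu]_x ((w x)%:E * g (phi x)) = c%:num%:E * \int[m]_y g y.
Proof.
move=> wm mg g0; pose f_ := nnsfun_approx measurableT mg.
have fg y : (f_ n y)%:E @[n --> \oo] --> g y by exact: cvg_nnsfun_approx.
have ndf y m' n : (m' <= n)%N -> (f_ m' y <= f_ n y)%R.
  by move=> mn; have /lefP := nd_nnsfun_approx measurableT mg mn; apply.
have mfphi n : measurable_fun setT (fun x => (f_ n (phi x))%:E).
  apply/measurable_EFinP; apply: measurableT_comp => //.
transitivity (limn (fun n => \int[mu]_x ((w x)%:E * (f_ n (phi x))%:E))).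
  rewrite -monotone_convergence//.
  - apply: eq_integral => x _; apply/esym/cvg_lim => //.
    exact: cvgeZl.
  - by move=> n; apply: emeasurable_funM.
  - by move=> n x _; rewrite mule_ge0// lee_fin.
  - move=> x _ m' n mn; by rewrite lee_wpmul2l ?lee_fin// ndf.
transitivity (limn (fun n => c%:num%:E * \int[m]_y (f_ n y)%:E)); last first.
  rewrite -ge0_integralZl//.
  transitivity (limn (fun n => \int[m]_y (c%:num%:E * (f_ n y)%:E))).
    congr (limn _); apply/funext => n; rewrite ge0_integralZl//.
    - exact/measurable_EFinP.
    - by move=> y _; rewrite lee_fin.
  rewrite -monotone_convergence//.
  - apply: eq_integral => y _; apply/cvg_lim => //.
    exact: cvgeZl.
  - move=> n; apply: emeasurable_funM => //; exact/measurable_EFinP.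
  - by move=> n y _; rewrite mule_ge0// lee_fin.
  - move=> y _ m' n mn; by rewrite lee_wpmul2l ?lee_fin// ndf.
congr (limn _); apply/funext => n.
have mpre1 k : measurable (f_ n @^-1` [set k]) by [].
have indE x k : \1_(f_ n @^-1` [set k]) (phi x) =
    \1_(phi @^-1` (f_ n @^-1` [set k])) x :> R by [].
transitivity (\sum_(k \in range (f_ n))
    \int[mu]_x ((w x)%:E * (k * \1_(f_ n @^-1` [set k]) (phi x))%:E)).
  rewrite -ge0_integral_fsum//; last 2 first.
  - move=> k; apply: emeasurable_funM => //; apply/measurable_EFinP.
    apply: measurable_funM => //.
    exact/measurable_indic/mpre.
  - move=> k x _; apply: mule_ge0; rewrite ?lee_fin //.
    by rewrite -lee_fin EFinM nnfun_muleindic_ge0.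
  apply: eq_integral => x _; rewrite fimfunE -fsumEFin// ge0_mule_fsumr//.
  by move=> k; rewrite EFinM nnfun_muleindic_ge0.
rewrite [X in _ = _ * X](_ : _ = \sum_(k \in range (f_ n))
    (k%:E * m (f_ n @^-1` [set k]))); last first.
  by rewrite integralT_nnsfun sintegralE.
rewrite ge0_mule_fsumr; last first.
  move=> k; have [k0|k0] := leP 0%R k; first by rewrite mule_ge0// lee_fin.
  by rewrite preimage_nnfun0// measure0 mule0.
apply: eq_fsbigr => k /[!inE] -[y _ fk].
have k0 : (0 <= k)%R by rewrite -fk.
rewrite muleCA -wm// -ge0_integralZl//.
- rewrite [RHS]integral_mkcond; apply: eq_integral => x _.
  rewrite EFinM muleCA patchE indE indicE.
  by case: ifPn => _; rewrite ?mule1 ?mule0.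
- exact: mpre.
- exact: measurable_funTS.
- by move=> x _; rewrite lee_fin.
Qed.

End WeightedPushforward.

(** Rectangles form a pi-system that generates the product sigma-algebra and both measures are
    finite, so agreement on rectangles is enough; Tonelli then gives the iterated integral. In the
    use below [w] collects the factors of the other observations. *)
Lemma ge0_integral_weighted_prod d (X : measurableType d) (R : realType)
    (mu : {measure set X -> \bar R}) (w xi zeta : X -> R)
    (m1 m2 : probability R R) (c : {nonneg R}) (g : R * R -> \bar R) :
  measurable_fun setT w -> (forall x, 0 <= w x) ->
  measurable_fun setT xi -> measurable_fun setT zeta ->
  (forall A B, measurable A -> measurable B ->
    \int[mu]_(x in xi @^-1` A `&` zeta @^-1` B) (w x)%:E =
    c%:num%:E * (m1 A * m2 B))%E ->
  measurable_fun setT g -> (forall y, (0 <= g y)%E) ->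
  (\int[mu]_x ((w x)%:E * g (xi x, zeta x)) =
   c%:num%:E * \int[m1]_x \int[m2]_y g (x, y))%E.
Proof.
move=> mw w0 mxi mze H mg g0.
pose phi x := (xi x, zeta x).
have mphi : measurable_fun setT phi by exact: measurable_fun_pair.
rewrite -fubini_tonelli1//.
apply: (@ge0_integral_weighted _ _ _ _ _ mu w phi) => // D mD.
have [nu nuD] := weighted_pushforward_measure mu mw w0 mphi.
rewrite -nuD; change (nu D = mscale c (m1 \x m2)%E D).
pose C : set (set (R * R)) :=
  [set C | exists A, measurable A /\ exists B, measurable B /\ C = A `*` B].
have CI : setI_closed C.
  move=> /= _ _ [X1 [mX1 [X2 [mX2 ->]]]] [Y1 [mY1 [Y2 [mY2 ->]]]].
  rewrite -setXI; exists (X1 `&` Y1); split; first exact: measurableI.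
  by exists (X2 `&` Y2); split => //; exact: measurableI.
have CT : C [set: R * R].
  by exists setT; split => //; exists setT; split => //; rewrite setXTT.
have nuE A : C A -> nu A = (mscale c (m1 \x m2)%E) A.
  move=> [A1 [mA1 [A2 [mA2 ->]]]].
  by rewrite /mscale/= product_measure1E// nuD -H.
apply: (measure_unique C (fun=> setT) _ CI _ _ nu) => //.
- rewrite measurable_prod_measurableType //; congr (<<s _ >>).
  rewrite predeqE; split => [[A mA [B mB <-]]|[A [mA [B [mB ->]]]]].
    by exists A; split => //; exists B.
  by exists A => //; exists B.
- by rewrite bigcup_const//; exists 0%N.
- move=> _; rewrite [X in (X < _)%E]nuE// /mscale/=.
  rewrite -setXTT product_measure1E//.
  rewrite [X in (_ * (X * _))%E](_ : _ = 1%E); last exact: probability_setT.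
  rewrite [X in (_ * (_ * X))%E](_ : _ = 1%E); last exact: probability_setT.
  by rewrite !mule1 ltry.
Qed.

(** * Exponential moments of squares of normal variables *)

Section GaussianLaw.
Variable R : realType.
Implicit Types (a l y : R) (m : probability R R).

(* The degenerate law is spelled out because the library's [normal_prob 0 0] is
   the uniform law on [0, 1]. *)
Definition centered_normal a m : Prop :=
  (0 < a /\ forall B, measurable B -> m B = normal_prob 0 a B) \/
  (a = 0 /\ forall B, measurable B -> m B = \d_(0 : R) B).

(** Completing the square: the tilted density is again a normal density up to a factor, so its
    integral is that factor. *)
Lemma normal_pdf_tilt a l x y : 0 < a -> 2 * l * a ^+ 2 < 1 ->
  normal_pdf 0 a x * expR (l * (x + y) ^+ 2) =
  (Num.sqrt (1 - 2 * l * a ^+ 2))^-1 * expR (l * y ^+ 2 / (1 - 2 * l * a ^+ 2)) *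
  normal_pdf (2 * l * y * a ^+ 2 / (1 - 2 * l * a ^+ 2))
    (a / Num.sqrt (1 - 2 * l * a ^+ 2)) x.
Proof.
move=> a0 la; set D := 1 - _; have D0 : 0 < D by rewrite subr_gt0.
have sD0 : 0 < Num.sqrt D by rewrite sqrtr_gt0.
rewrite !normal_pdfE; [|by rewrite gt_eqF// divr_gt0|by rewrite gt_eqF].
rewrite /= /normal_fun.
have -> : normal_peak (a / Num.sqrt D) = Num.sqrt D * normal_peak a.
  have u0 : 0 <= a ^+ 2 * pi *+ 2 by rewrite mulrn_wge0// mulr_ge0 ?sqr_ge0 ?pi_ge0.
  rewrite /normal_peak exprMn exprVn sqr_sqrtr ?(ltW D0)//.
  have -> : a ^+ 2 / D * pi *+ 2 = (a ^+ 2 * pi *+ 2) * D^-1.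
    by rewrite mulrnAl; congr (_ *+ _); ring.
  by rewrite sqrtrM// sqrtrV ?(ltW D0)// invfM invrK mulrC.
rewrite subr0 mulrACA -expRD (mulrA _^-1) mulVf ?gt_eqF// mul1r.
rewrite -(mulrA (normal_peak a)) -expRD; congr (_ * expR _).
rewrite exprMn exprVn sqr_sqrtr ?(ltW D0)//.
have E : 1 - 2 * l * a ^+ 2 != 0 by rewrite gt_eqF.
rewrite /D; field.
by rewrite E gt_eqF.
Qed.

Lemma ge0_integral_normal a m (f : R -> \bar R) :
  (forall B, measurable B -> m B = normal_prob 0 a B) ->
  measurable_fun setT f -> (forall x, 0 <= f x)%E ->
  (\int[m]_x f x = \int[lebesgue_measure]_x ((normal_pdf 0 a x)%:E * f x))%E.
Proof.
move=> mE mf f0.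
rewrite (@ge0_integral_weighted _ _ (measurableTypeR R) R _ lebesgue_measure
  (normal_pdf 0 a) id _ _ _ m 1%:nng f) ?mul1e//.
- exact: measurable_normal_pdf.
- by move=> x; exact: normal_pdf_ge0.
- by move=> D mD; rewrite preimage_id mul1e; exact/esym/mE.
Qed.

Lemma measurable_expR_sq (l y : R) :
  measurable_fun setT (fun x : R => (expR (l * (x + y) ^+ 2))%:E).
Proof.
apply/measurable_EFinP; apply: measurableT_comp => //.
apply: measurable_funM => //; apply: measurable_funX.
exact: measurable_funD.
Qed.

Lemma centered_normal_mgf_sq a m l y : centered_normal a m ->
  2 * l * a ^+ 2 < 1 ->
  (\int[m]_x (expR (l * (x + y) ^+ 2))%:E =
   ((Num.sqrt (1 - 2 * l * a ^+ 2))^-1 * expR (l * y ^+ 2 / (1 - 2 * l * a ^+ 2)))%:E)%E.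
Proof.
move=> [[a0 mE]|[-> mE]] la; last first.
  transitivity (\int[dirac (0%R : R)]_x (expR (l * (x + y) ^+ 2))%:E)%E.
    by apply: eq_measure_integral => B mB _; exact: mE.
  rewrite integral_dirac//; last exact: measurable_expR_sq.
  by rewrite diracT mul1e add0r expr0n/= mulr0 subr0 sqrtr1 invr1 mul1r mulr1.
rewrite (ge0_integral_normal mE);
  [|exact: measurable_expR_sq|by move=> x; rewrite lee_fin expR_ge0].
under eq_integral do rewrite -EFinM normal_pdf_tilt// EFinM.
rewrite ge0_integralZl//.
- by rewrite integral_normal_pdf mule1.
- by apply/measurable_EFinP; exact: measurable_normal_pdf.
- by move=> x _; rewrite lee_fin normal_pdf_ge0.
Qed.

(** Integrating the inner variable leaves the exponential of a square with exponent [l / D2], to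
    which the one-variable formula applies again; this is why that formula carries a shift [y]. *)
Lemma centered_normal2_mgf_sq a b m1 m2 l : centered_normal a m1 -> centered_normal b m2 ->
  2 * l * (a ^+ 2 + b ^+ 2) < 1 ->
  (\int[m1]_x \int[m2]_y (expR (l * (x + y) ^+ 2))%:E =
   ((Num.sqrt (1 - 2 * l * (a ^+ 2 + b ^+ 2)))^-1)%:E)%E.
Proof.
move=> G1 G2 lab; set D2 := 1 - 2 * l * b ^+ 2.
(* For [l <= 0] one has [D2 >= 1]; for [l > 0] dropping [a ^+ 2] only weakens the assumption. *)
have D20 : 0 < D2.
  by rewrite /D2; have := sqr_ge0 a; have := sqr_ge0 b; have [l0|l0] := leP l 0; nra.
have E : 1 - 2 * l * (a ^+ 2 + b ^+ 2) = D2 - 2 * l * a ^+ 2 by rewrite /D2; ring.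
have la : 2 * (l / D2) * a ^+ 2 < 1.
  have -> : 2 * (l / D2) * a ^+ 2 = (2 * l * a ^+ 2) / D2 by ring.
  by rewrite ltr_pdivrMr// mul1r -subr_gt0 -E subr_gt0.
transitivity (\int[m1]_x ((Num.sqrt D2)^-1%:E * (expR (l / D2 * (x + 0) ^+ 2))%:E))%E.
  apply: eq_integral => x _.
  under eq_integral do rewrite addrC.
  rewrite (centered_normal_mgf_sq _ G2); last by rewrite -subr_gt0.
  by rewrite -/D2 EFinM addr0 mulrAC.
rewrite ge0_integralZl//.
- rewrite (centered_normal_mgf_sq _ G1)// expr0n/= mulr0 mul0r expR0 mulr1 -EFinM.
  congr EFin; rewrite E.
  have -> : D2 - 2 * l * a ^+ 2 = D2 * (1 - 2 * (l / D2) * a ^+ 2).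
    by field; rewrite gt_eqF.
  by rewrite sqrtrM ?(ltW D20)// invfM.
- exact: measurable_expR_sq.
Qed.

End GaussianLaw.

(** * Integral of a product over independent pairs *)

Section IndependentProduct.
Context d (T : measurableType d) (R : realType) (P : probability T R).
Variables (n : nat) (xi zeta : 'I_n -> T -> R) (m1 m2 : probability R R).
Variables (h : R * R -> R) (I : R).
Hypothesis mxi : forall i, measurable_fun setT (xi i).
Hypothesis mzeta : forall i, measurable_fun setT (zeta i).
Hypothesis mh : measurable_fun setT h.
Hypothesis h0 : forall z, 0 <= h z.
Hypothesis I0 : 0 <= I.
Hypothesis hI : (\int[m1]_x \int[m2]_y (h (x, y))%:E = I%:E)%E.
Hypothesis indep : forall A B : 'I_n -> set R,
  (forall i, measurable (A i)) -> (forall i, measurable (B i)) ->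
  P (\bigcap_(i in setT) (xi i @^-1` A i `&` zeta i @^-1` B i)) =
  (\prod_(i < n) (fine (m1 (A i)) * fine (m2 (B i))))%:E.

Let mpre (f : T -> R) (A : set R) : measurable_fun setT f -> measurable A ->
  measurable (f @^-1` A).
Proof. by move=> mf mA; rewrite -[_ @^-1` _]setTI; exact: mf. Qed.

(* The coordinates below [k] are already integrated against [h], the others
   are still tested by events. *)
Let factor k (A B : 'I_n -> set R) (i : 'I_n) (x : T) : R :=
  if (i < k)%N then h (xi i x, zeta i x)
  else \1_(A i) (xi i x) * \1_(B i) (zeta i x).

Let value k (A B : 'I_n -> set R) (i : 'I_n) : R :=
  if (i < k)%N then I else fine (m1 (A i)) * fine (m2 (B i)).

Let factor_ge0 k A B i x : 0 <= factor k A B i x.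
Proof. by rewrite /factor; case: ifP => // _; rewrite mulr_ge0. Qed.

Let value_ge0 k A B i : 0 <= value k A B i.
Proof. by rewrite /value; case: ifP => // _; rewrite mulr_ge0// fine_ge0. Qed.

Let measurable_factor k A B i : measurable (A i) -> measurable (B i) ->
  measurable_fun setT (factor k A B i).
Proof.
move=> mA mB; rewrite /factor; have [ik|ik] := ltnP i k.
  by apply: (measurableT_comp mh); exact: measurable_fun_pair.
by apply: measurable_funM; apply: measurableT_comp => //; exact: measurable_indic.
Qed.

(** Induction on the number of integrated coordinates. The test sets stay arbitrary because the
    rectangle condition needed to integrate coordinate [k] is the previous stage with other sets at
    that coordinate. *)
Let integral_factors k A B : (k <= n)%N ->
  (forall i, measurable (A i)) -> (forall i, measurable (B i)) ->
  (\int[P]_x (\prod_(i < n) factor k A B i x)%:E = (\prod_(i < n) value k A B i)%:E)%E.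
Proof.
elim: k A B => [|k IH] A B kn mA mB.
  have -> : \prod_(i < n) value 0 A B i =
      \prod_(i < n) (fine (m1 (A i)) * fine (m2 (B i))).
    by apply: eq_bigr => i _; rewrite /value ltn0.
  rewrite -indep// -[X in P X]setIT -integral_indic//; last first.
    apply: fin_bigcap_measurable => // i _.
    by apply: measurableI; apply: mpre.
  apply: eq_integral => x _; congr EFin.
  rewrite indicE; case: (boolP (x \in _)).
    rewrite inE => xAB; rewrite big1// => i _; rewrite /factor ltn0.
    have [Ax Bx] := xAB i Logic.I.
    by rewrite !indicE !mem_set// mulr1.
  rewrite notin_setE => xAB.
  have [i /not_andP iAB] : exists i, ~ (A i (xi i x) /\ B i (zeta i x)).
    by apply/existsNP => H; apply: xAB => i _; exact: H.
  rewrite (bigD1 i)//= {1}/factor ltn0 !indicE.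
  by case: iAB => iAB; rewrite (memNset iAB) ?mul0r ?mulr0 ?mul0r.
pose j := Ordinal kn.
pose w x := \prod_(i < n | i != j) factor k.+1 A B i x.
have w0 x : 0 <= w x by apply: prodr_ge0.
have c0 : 0 <= \prod_(i < n | i != j) value k.+1 A B i by apply: prodr_ge0.
have mw : measurable_fun setT w.
  rewrite /w; under eq_fun do rewrite -big_filter.
  apply: measurable_prod => i _; exact: measurable_factor.
transitivity (\int[P]_x ((w x)%:E * (h (xi j x, zeta j x))%:E))%E.
  apply: eq_integral => x _; rewrite -EFinM (bigD1 j)//= mulrC; congr (_ * _)%:E.
  by rewrite /factor /= ltnSn.
rewrite (@ge0_integral_weighted_prod _ _ _ P w (xi j) (zeta j) m1 m2
  (NngNum c0) (EFin \o h))//=.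
- rewrite hI -EFinM; congr EFin; rewrite [in RHS](bigD1 j)//= mulrC; congr (_ * _).
  by rewrite /value /= ltnSn.
- move=> A' B' mA' mB'.
  (* Coordinate [j] is still tested by events at stage [k], so the restriction to the rectangle
     [A'], [B'] can be written into its test sets. *)
  pose A1 i := if i == j then A' else A i.
  pose B1 i := if i == j then B' else B i.
  have := IH A1 B1 (ltnW kn).
  have mA1 i : measurable (A1 i) by rewrite /A1; case: ifP.
  have mB1 i : measurable (B1 i) by rewrite /B1; case: ifP.
  move=> /(_ mA1 mB1) IH1.
  have ij i : i != j -> (i < k.+1)%N = (i < k)%N.
    by move=> ij; rewrite ltnS leq_eqVlt -(inj_eq val_inj) in ij *; rewrite (negbTE ij).
  transitivity (\int[P]_x (\prod_(i < n) factor k A1 B1 i x)%:E)%E.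
    rewrite integral_mkcond; apply: eq_integral => x _; rewrite patchE (bigD1 j)//=.
    have -> : \prod_(i < n | i != j) factor k A1 B1 i x = w x.
      by apply: eq_bigr => i /[dup] /ij e ij'; rewrite /factor e /A1 /B1 (negbTE ij').
    rewrite /factor /= ltnn /A1 /B1 eqxx !indicE.
    rewrite in_setI.
    have -> : (x \in xi j @^-1` A') = (xi j x \in A') by [].
    have -> : (x \in zeta j @^-1` B') = (zeta j x \in B') by [].
    by case: (_ \in _) => /=; case: (_ \in _) => /=; rewrite ?mul1r ?mul0r.
  rewrite IH1 (bigD1 j)//= mulrC EFinM; congr (_%:E * _)%E.
    by apply: eq_bigr => i /[dup] /ij e ij'; rewrite /value e /A1 /B1 (negbTE ij').
  rewrite /value /= ltnn /A1 /B1 eqxx EFinM.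
  by congr (_ * _)%E; rewrite fineK// fin_num_measure.
- exact/measurable_EFinP.
Qed.

Lemma integral_indep_prod :
  (\int[P]_x (\prod_(i < n) h (xi i x, zeta i x))%:E = (I ^+ n)%:E)%E.
Proof.
transitivity (\int[P]_x (\prod_(i < n) factor n (fun=> setT) (fun=> setT) i x)%:E)%E.
  apply: eq_integral => x _; congr EFin; apply: eq_bigr => i _.
  by rewrite /factor ltn_ord.
rewrite integral_factors//; congr EFin.
under eq_bigr do rewrite /value ltn_ord.
by rewrite prodr_const card_ord.
Qed.

End IndependentProduct.

(** * Exponential moments of Gaussian quadratic forms *)

Section LatentLaw.
Context d (T : measurableType d) (R : realType) (P : probability T R).

Lemma law_exists (f : T -> R) : measurable_fun setT f ->
  exists m : probability R R, forall B, measurable B -> m B = P (f @^-1` B).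
Proof.
move=> mf.
pose F : {mfun T >-> R} := HB.pack f (isMeasurableFun.Build _ _ _ _ f mf).
by exists (distribution P F).
Qed.

Lemma measurable_lincomb (I : finType) (Y : I -> T -> R) (u : I -> R) :
  (forall i, measurable_fun setT (Y i)) ->
  measurable_fun setT (fun w => \sum_i u i * Y i w).
Proof.
by move=> mY; apply: measurable_sum => i; apply: measurable_funM.
Qed.

(** When [T] is given the sigma-algebra generated by the [Y i], each [Y i] is measurable by
    definition, hence so are linear combinations. *)
Lemma sigma_of_lincomb (I : finType) (Y : I -> T -> R) (u : I -> R) (B : set R) :
  measurable B -> sigma_of Y ((fun w => \sum_i u i * Y i w) @^-1` B).
Proof.
move=> mB.
set G := [set A | exists (j : I) (B : set R), measurable B /\ A = Y j @^-1` B].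
pose T' := g_sigma_algebraType G.
have mY i : measurable_fun (setT : set T') (Y i).
  move=> _ B' mB'; rewrite setTI; apply: sub_sigma_algebra.
  by exists i, B'.
have mS : measurable_fun (setT : set T') (fun w : T' => \sum_i u i * Y i w).
  by apply: measurable_sum => i; apply: measurable_funM.
by have := mS measurableT B mB; rewrite setTI.
Qed.

Lemma bigsetI_fintype (I : finType) (F : I -> set T) :
  \big[setI/setT]_(i in [set: I]%SET) F i = \bigcap_(i in setT) F i.
Proof.
apply/seteqP; split => x.
  move=> H i _; move: H; rewrite (bigD1 i)//= ?inE//; by case.
move=> H; elim/big_ind: _ => // i _; exact: H.
Qed.

(** [centered_gaussian] is silent about [u = 0]; the combination is then constantly zero and its law
    is the Dirac mass of [centered_normal]. *)
Lemma centered_normal_law (I : finType) (Y : I -> T -> R) (S : I -> I -> R)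
    (u : I -> R) (m : probability R R) :
  centered_gaussian P Y S ->
  ((exists i, u i != 0) -> 0 < \sum_i \sum_j u i * u j * S i j) ->
  (forall B, measurable B -> m B = P ((fun w => \sum_i u i * Y i w) @^-1` B)) ->
  centered_normal (Num.sqrt (\sum_i \sum_j u i * u j * S i j)) m.
Proof.
move=> [mY gY] upos mE.
have [u0|u0] := pselect (exists i, u i != 0).
  left; split; first by rewrite sqrtr_gt0 upos.
  by move=> B mB; rewrite mE// -gY.
have {}u0 i : u i = 0.
  by apply/eqP/negP => ui; apply: u0; exists i; apply/negP.
right; split.
  by rewrite big1 ?sqrtr0// => i _; rewrite big1// => j _; rewrite u0 !mul0r.
move=> B mB; rewrite mE//.
have -> : (fun w => \sum_i u i * Y i w) = fun=> 0.
  by apply/funext => w; rewrite big1// => i _; rewrite u0 mul0r.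
rewrite preimage_cst diracE.
by case: ifPn => _; rewrite ?probability_setT ?measure0.
Qed.

End LatentLaw.

Lemma chi2_mgf_bound (R : realType) (z : R) : `|z| <= 8^-1 ->
  (Num.sqrt (1 - 2 * z))^-1 <= expR (z + 3 * z ^+ 2).
Proof.
rewrite ler_norml => /andP[z1 z2].
have D0 : 0 < 1 - 2 * z by lra.
have E0 : 0 < expR (z + 3 * z ^+ 2) by exact: expR_gt0.
rewrite -[leLHS]mul1r ler_pdivrMr ?sqrtr_gt0//.
rewrite -(ler_pXn2r (_ : 0 < 2)%N) ?nnegrE ?mulr_ge0 ?sqrtr_ge0 ?(ltW E0)//.
rewrite expr1n exprMn sqr_sqrtr ?(ltW D0)// -expRM_natl.
(* The product equals [1 + 2 * z ^+ 2 * (1 - 6 * z)], which is at least 1 for [z <= 8^-1]. *)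
apply: (@le_trans _ _ ((1 + 2 * (z + 3 * z ^+ 2)) * (1 - 2 * z))).
  by have := sqr_ge0 z; nra.
by rewrite ler_wpM2r ?(ltW D0)// expR_ge1Dx.
Qed.

Section DataMgf.
Context (R : realType) d (T : measurableType d) (P : probability T R).
Variables (K p n : nat) (kG : 'I_p -> 'I_K) (C : 'M[R]_K) (gam : 'I_K -> R).
Variables (Z : 'I_n -> 'I_K -> T -> R) (E : 'I_n -> 'I_p -> T -> R).
Hypotheses (Cpos : posdef C) (gam0 : forall k, 0 < gam k) (n0 : (0 < n)%N).
Hypothesis gZ : forall i, centered_gaussian P (Z i) (fun k l => C k l).
Hypothesis gE : forall i,
  centered_gaussian P (E i) (fun a b => (a == b)%:R * gam (kG a)).
Hypothesis ind : mutually_indep P (fun ib : 'I_n * bool =>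
  if ib.2 then sigma_of (Z ib.1) else sigma_of (E ib.1)).

Variable v : 'cV[R]_p.
Let u k := ((memb R kG)^T *m v) k 0.
Let xi i w := \sum_k u k * Z i k w.
Let zeta i w := \sum_a v a 0 * E i a w.
Let a2 := \sum_k \sum_l u k * u l * C k l.
Let b2 := \sum_a \sum_b v a 0 * v b 0 * ((a == b)%:R * gam (kG a)).
Let tau := (v^T *m SigmaMod kG C gam *m v) 0 0.

Let mxi i : measurable_fun setT (xi i).
Proof. by apply: measurable_lincomb => k; have [] := gZ i. Qed.

Let mzeta i : measurable_fun setT (zeta i).
Proof. by apply: measurable_lincomb => k; have [] := gE i. Qed.

Let a2E : a2 = (((memb R kG)^T *m v)^T *m C *m ((memb R kG)^T *m v)) 0 0.
Proof.
rewrite /a2 mxE exchange_big /=; apply: eq_bigr => l _.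
rewrite mxE big_distrl/=; apply: eq_bigr => k _.
by rewrite [X in _ = X * _ * _]mxE mulrAC.
Qed.

Let b2E : b2 = \sum_a v a 0 ^+ 2 * gam (kG a).
Proof.
rewrite /b2; apply: eq_bigr => a _; rewrite (bigD1 a)//= eqxx mul1r big1 ?addr0 ?expr2//.
by move=> b ba; rewrite eq_sym (negbTE ba) mul0r mulr0.
Qed.

Let tauE : tau = a2 + b2.
Proof.
rewrite /tau /SigmaMod mulmxDr mulmxDl mxE a2E b2E; congr (_ + _).
  by rewrite trmx_mul trmxK !mulmxA.
rewrite mxE; apply: eq_bigr => a _.
by rewrite mul_mx_diag !mxE mulrAC expr2.
Qed.

Let a2_gt0 : (exists k, u k != 0) -> 0 < a2.
Proof.
move=> [k uk]; rewrite a2E.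
have := Cpos.2 (((memb R kG)^T *m v)^T); rewrite trmxK; apply.
apply/eqP => /matrixP /(_ 0 k); rewrite !mxE => H.
by move: uk; rewrite /u !mxE H eqxx.
Qed.

Let b2_gt0 : (exists a, v a 0 != 0) -> 0 < b2.
Proof.
move=> [a va]; rewrite b2E (bigD1 a)//=.
have va2 : 0 < v a 0 ^+ 2 by rewrite exprn_even_gt0.
rewrite ltr_pwDl ?(mulr_gt0 va2)//.
by apply: sumr_ge0 => b _; rewrite mulr_ge0 ?sqr_ge0// ltW.
Qed.

Let ge0_of_gt0 (I : finType) (w : I -> R) (S : I -> I -> R) :
  ((exists i, w i != 0) -> 0 < \sum_i \sum_j w i * w j * S i j) ->
  0 <= \sum_i \sum_j w i * w j * S i j.
Proof.
move=> H; have [/H/ltW//|w0] := pselect (exists i, w i != 0).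
rewrite big1// => i _; rewrite big1// => j _.
suff -> : w i = 0 by rewrite !mul0r.
by apply/eqP/negP => wi; apply: w0; exists i; apply/negP.
Qed.

Lemma data_quadform_ge0 : 0 <= tau.
Proof. by rewrite tauE addr_ge0// ge0_of_gt0. Qed.

Let indep_law (m1 m2 : probability R R) :
  (forall i B, measurable B -> m1 B = P (xi i @^-1` B)) ->
  (forall i B, measurable B -> m2 B = P (zeta i @^-1` B)) ->
  forall A B : 'I_n -> set R,
  (forall i, measurable (A i)) -> (forall i, measurable (B i)) ->
  P (\bigcap_(i in setT) (xi i @^-1` A i `&` zeta i @^-1` B i)) =
  (\prod_(i < n) (fine (m1 (A i)) * fine (m2 (B i))))%:E.
Proof.
move=> m1E m2E A B mA mB.
pose Ev (ib : 'I_n * bool) := if ib.2 then xi ib.1 @^-1` A ib.1 else zeta ib.1 @^-1` B ib.1.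
have := @ind [set: 'I_n * bool]%SET Ev.
have EvF ib : ib \in [set: 'I_n * bool]%SET ->
    (if ib.2 then sigma_of (Z ib.1) else sigma_of (E ib.1)) (Ev ib).
  by case: ib => i [] _ /=; exact: sigma_of_lincomb.
move=> /(_ EvF); rewrite bigsetI_fintype => H.
have -> : \bigcap_(i in setT) (xi i @^-1` A i `&` zeta i @^-1` B i) =
    \bigcap_(i in setT) Ev i.
  apply/seteqP; split => x Hx.
    by move=> [i []] _; have [] := Hx i Logic.I.
  by move=> i _; split; [exact: (Hx (i, true))|exact: (Hx (i, false))].
rewrite H -prodEFin.
transitivity (\prod_(i < n) \prod_(b : bool) P (Ev (i, b)))%E.
  rewrite pair_big/=; apply: eq_big => [x|[i b] _]//=.
  by rewrite inE.
apply: eq_bigr => i _; rewrite big_bool/= EFinM.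
by rewrite /Ev/= !fineK ?fin_num_measure// -m1E// -m2E.
Qed.

(** Row [i] of the data applied to [v] is [xi i + zeta i], a sum of independent normal variables of
    total variance [a2 + b2 = tau]; the exponential of the sum of squares factors over [i]. *)
Lemma data_sq_expectation (l : R) : 2 * l * tau < 1 ->
  (\int[P]_w (expR (l * \sum_i ((data_matrix kG Z E w *m v) i 0) ^+ 2))%:E =
  ((Num.sqrt (1 - 2 * l * tau))^-1 ^+ n)%:E)%E.
Proof.
move=> lt.
have XE w i : (data_matrix kG Z E w *m v) i 0 = xi i w + zeta i w.
  rewrite mxE; under eq_bigr do rewrite mxE mulrDl.
  rewrite big_split/=; congr (_ + _); last first.
    by apply: eq_bigr => a _; rewrite mulrC.
  rewrite /xi; under [RHS]eq_bigr => k _ do rewrite /u mxE big_distrl/=.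
  rewrite exchange_big/=; apply: eq_bigr => a _.
  rewrite (bigD1 (kG a))//= !mxE eqxx mul1r big1 ?addr0 1?mulrC//.
  by move=> k ka; rewrite !mxE eq_sym (negbTE ka) !mul0r.
pose i0 := Ordinal n0.
have [m1 m1E] := law_exists P (mxi i0).
have [m2 m2E] := law_exists P (mzeta i0).
have g1 := centered_normal_law (gZ i0) a2_gt0 m1E.
have g2 := centered_normal_law (gE i0) b2_gt0 m2E.
(* All observations share the law of [xi i0]: by the Gaussian assumption if [u] is nonzero, and
   because every [xi i] vanishes identically otherwise. *)
have m1E' i B : measurable B -> m1 B = P (xi i @^-1` B).
  move=> mB; rewrite m1E//.
  have [[k uk]|u0] := pselect (exists k, u k != 0).
    transitivity (normal_prob 0 (Num.sqrt a2) B).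
      by apply: (gZ i0).2 => //; exists k.
    by apply/esym/(gZ i).2 => //; exists k.
  have u00 k : u k = 0.
    by apply/eqP/negP => wi; apply: u0; exists k; apply/negP.
  have z0 i' : xi i' = fun=> 0.
    by apply/funext => w; rewrite /xi big1// => k _; rewrite u00 mul0r.
  by rewrite !z0.
have m2E' i B : measurable B -> m2 B = P (zeta i @^-1` B).
  move=> mB; rewrite m2E//.
  have [[k uk]|u0] := pselect (exists k, v k 0 != 0).
    transitivity (normal_prob 0 (Num.sqrt b2) B).
      by apply: (gE i0).2 => //; exists k.
    by apply/esym/(gE i).2 => //; exists k.
  have u00 k : v k 0 = 0.
    by apply/eqP/negP => wi; apply: u0; exists k; apply/negP.
  have z0 i' : zeta i' = fun=> 0.
    by apply/funext => w; rewrite /zeta big1// => k _; rewrite u00 mul0r.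
  by rewrite !z0.
pose h (z : R * R) := expR (l * (z.1 + z.2) ^+ 2).
have lt' : 2 * l * (Num.sqrt a2 ^+ 2 + Num.sqrt b2 ^+ 2) < 1.
  by rewrite !sqr_sqrtr ?ge0_of_gt0// -tauE.
have hI := centered_normal2_mgf_sq g1 g2 lt'.
rewrite !sqr_sqrtr ?ge0_of_gt0// -/a2 -/b2 -tauE in hI.
have mh : measurable_fun setT h.
  apply: measurableT_comp => //; apply: measurable_funM => //.
  apply: measurable_funX; apply: measurable_funD => //.
rewrite -(@integral_indep_prod _ _ _ P n xi zeta m1 m2 h _ mxi mzeta mh _ _ hI).
- apply: eq_integral => w _; congr EFin.
  rewrite mulr_sumr expR_sum; apply: eq_bigr => i _.
  by rewrite /h/= XE.
- by move=> z; exact: expR_ge0.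
- by rewrite invr_ge0 sqrtr_ge0.
- exact: indep_law.
Qed.

Lemma measurable_data_sq (l c : R) : measurable_fun setT
  (fun w => expR (l * \sum_i ((data_matrix kG Z E w *m v) i 0) ^+ 2 + c)).
Proof.
apply: measurableT_comp => //; apply: measurable_funD => //.
apply: measurable_funM => //; apply: measurable_sum => i.
apply: measurable_funX; under eq_fun do rewrite mxE.
apply: measurable_sum => a; apply: measurable_funM => //.
under eq_fun do rewrite mxE.
by apply: measurable_funD; [have [+ _] := gZ i|have [+ _] := gE i]; apply.
Qed.

(** [chi2_mgf_bound] at [z = l * tau], to the power [n]. The subtracted terms are the mean of the
    exponent and a bound of order [n * (l * tau) ^+ 2] for its fluctuation. *)
Lemma data_sq_mgf (l : R) : `|l| * tau <= 8^-1 ->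
  (\int[P]_w (expR (l * \sum_i ((data_matrix kG Z E w *m v) i 0) ^+ 2
      + - (l * (n%:R * tau) + 3 * n%:R * l ^+ 2 * tau ^+ 2)))%:E <= 1%:E)%E.
Proof.
move=> lt.
have t0 := data_quadform_ge0.
have lt' : `|l * tau| <= 8^-1 by rewrite normrM (ger0_norm t0).
under eq_integral do rewrite expRD EFinM muleC.
rewrite ge0_integralZl//; last first.
- have := measurable_data_sq l 0; under eq_fun do rewrite addr0.
  by move=> /measurable_EFinP.
rewrite data_sq_expectation; last first.
  by move: lt'; rewrite ler_norml => /andP[]; lra.
rewrite -EFinM lee_fin -ler_pdivlMl ?expR_gt0// mulr1 expRN invrK.
apply: (@le_trans _ _ (expR (l * tau + 3 * (l * tau) ^+ 2) ^+ n)).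
  rewrite lerXn2r ?nnegrE ?invr_ge0 ?sqrtr_ge0 ?expR_ge0//.
  by rewrite -mulrA; exact: chi2_mgf_bound.
by rewrite -expRM_natl ler_expR; rewrite le_eqVlt; apply/orP; left; apply/eqP; ring.
Qed.

End DataMgf.

Lemma markov_event d (T : measurableType d) (R : realType) (P : probability T R)
    (F : T -> R) (c t : R) :
  measurable_fun setT F -> (forall w, 0 <= F w) -> 0 < t ->
  (\int[P]_w (F w)%:E <= c%:E)%E ->
  exists A, [/\ measurable A, forall w, A w -> F w <= t & ((1 - c / t)%:E <= P A)%E].
Proof.
move=> mF F0 t0 Fc.
have mB : measurable [set w | t <= F w].
  by rewrite -[X in measurable X]setTI; exact: measurable_fun_le.
exists (~` [set w | t <= F w]); split.
- exact: measurableC.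
- by move=> w /= /negP; rewrite -ltNge => /ltW.
rewrite probability_setC// EFinB leeB//.
have mEF : measurable_fun setT (EFin \o F) by exact/measurable_EFinP.
have := le_integral_abse P measurableT mEF t0; rewrite setTI.
have -> : [set x | (t%:E <= `|(EFin \o F) x|)%E] = [set w | t <= F w].
  by apply/seteqP; split => w /=; rewrite lee_fin ger0_norm.
under eq_integral do rewrite /= ger0_norm//.
move=> H; rewrite mulrC EFinM lee_pdivlMl//.
exact: le_trans H Fc.
Qed.

(** The bound on the sum serves twice: a single term is controlled at the price [p / c j], while a
    whole subfamily is controlled as an average over a prior. *)
Lemma data_event (R : realType) d (T : measurableType d) (P : probability T R)
  (K p n : nat) (kG : 'I_p -> 'I_K) (C : 'M[R]_K) (gam : 'I_K -> R)
  (Z : 'I_n -> 'I_K -> T -> R) (E : 'I_n -> 'I_p -> T -> R)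
  (J : finType) (c : J -> R) (v : J -> 'cV[R]_p) (l : J -> R) (c2 : R) :
  posdef C -> (forall k, 0 < gam k) -> (0 < n)%N -> (0 < p)%N ->
  (forall i, centered_gaussian P (Z i) (fun k l => C k l)) ->
  (forall i, centered_gaussian P (E i) (fun a b => (a == b)%:R * gam (kG a))) ->
  mutually_indep P (fun ib : 'I_n * bool =>
    if ib.2 then sigma_of (Z ib.1) else sigma_of (E ib.1)) ->
  let tau j := ((v j)^T *m SigmaMod kG C gam *m v j) 0 0 in
  (forall j, 0 <= c j) -> (forall j, `|l j| * tau j <= 8^-1) -> \sum_j c j <= c2 ->
  exists A, [/\ measurable A,
    forall w, A w -> \sum_j c j *
      expR (l j * \sum_i ((data_matrix kG Z E w *m v j) i 0) ^+ 2
        + - (l j * (n%:R * tau j) + 3 * n%:R * l j ^+ 2 * tau j ^+ 2)) <= p%:R &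
    ((1 - c2 / p%:R)%:E <= P A)%E].
Proof.
move=> Cp g0 n0 p0 gZ gE ind tau c0 ltau csum.
apply: markov_event.
- apply: measurable_sum => j; apply: measurable_funM => //.
  exact: (measurable_data_sq gZ gE).
- by move=> w; apply: sumr_ge0 => j _; rewrite mulr_ge0// expR_ge0.
- by rewrite ltr0n.
under eq_integral do rewrite -sumEFin.
rewrite ge0_integral_sum//; last 2 first.
- move=> j; apply/measurable_EFinP; apply: measurable_funM => //.
  exact: (measurable_data_sq gZ gE).
- by move=> j w _; rewrite lee_fin mulr_ge0// expR_ge0.
apply: (@le_trans _ _ (\sum_j c j)%:E); last by rewrite lee_fin.
rewrite -sumEFin; apply: lee_sum => j _.
under eq_integral do rewrite EFinM.
rewrite ge0_integralZl//.
- rewrite -[leRHS]mule1; apply: lee_wpmul2l; first by rewrite lee_fin.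
  exact: (data_sq_mgf Cp g0 n0 gZ gE ind).
- by apply/measurable_EFinP; exact: (measurable_data_sq gZ gE).
- by rewrite lee_fin.
Qed.

(** * Bilinear forms, operator norm, smallest eigenvalue *)

Section BilinearForms.
Variable R : realType.

Definition bil q r (M : 'M[R]_(q, r)) (x : 'cV[R]_q) (y : 'cV[R]_r) : R :=
  (x^T *m M *m y) 0 0.
Definition dotv q (x y : 'cV[R]_q) : R := (x^T *m y) 0 0.

Lemma dotvE q (x y : 'cV[R]_q) : dotv x y = \sum_i x i 0 * y i 0.
Proof. by rewrite /dotv mxE; apply: eq_bigr => i _; rewrite mxE. Qed.

Lemma dotvC q (x y : 'cV[R]_q) : dotv x y = dotv y x.
Proof. by rewrite !dotvE; apply: eq_bigr => i _; rewrite mulrC. Qed.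

Lemma bil_dot q r (M : 'M[R]_(q, r)) x y : bil M x y = dotv x (M *m y).
Proof. by rewrite /bil /dotv mulmxA. Qed.

Lemma bil_dotl q r (M : 'M[R]_(q, r)) x y : bil M x y = dotv (M^T *m x) y.
Proof. by rewrite /bil /dotv trmx_mul trmxK. Qed.

Lemma bil_tr q r (M : 'M[R]_(q, r)) x y : bil M^T y x = bil M x y.
Proof. by rewrite bil_dotl trmxK dotvC -bil_dot. Qed.

Lemma bil1 q (x y : 'cV[R]_q) : bil 1%:M x y = dotv x y.
Proof. by rewrite bil_dot mul1mx. Qed.

Lemma bilE q r (M : 'M[R]_(q, r)) x y :
  bil M x y = \sum_i \sum_j x i 0 * y j 0 * M i j.
Proof.
rewrite bil_dot dotvE; apply: eq_bigr => i _; rewrite mxE big_distrr/=.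
by apply: eq_bigr => j _; ring.
Qed.

Lemma bilDl q r (M : 'M[R]_(q, r)) x x' y : bil M (x + x') y = bil M x y + bil M x' y.
Proof. by rewrite /bil linearD !mulmxDl mxE. Qed.
Lemma bilDr q r (M : 'M[R]_(q, r)) x y y' : bil M x (y + y') = bil M x y + bil M x y'.
Proof. by rewrite /bil mulmxDr mxE. Qed.
Lemma bilZl q r (M : 'M[R]_(q, r)) a x y : bil M (a *: x) y = a * bil M x y.
Proof. by rewrite /bil linearZ -!scalemxAl mxE. Qed.
Lemma bilZr q r (M : 'M[R]_(q, r)) a x y : bil M x (a *: y) = a * bil M x y.
Proof. by rewrite /bil -scalemxAr mxE. Qed.
Lemma bilNl q r (M : 'M[R]_(q, r)) x y : bil M (- x) y = - bil M x y.
Proof. by rewrite -scaleN1r bilZl mulN1r. Qed.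
Lemma bilNr q r (M : 'M[R]_(q, r)) x y : bil M x (- y) = - bil M x y.
Proof. by rewrite -scaleN1r bilZr mulN1r. Qed.
Lemma bil_addmx q r (M N : 'M[R]_(q, r)) x y : bil (M + N) x y = bil M x y + bil N x y.
Proof. by rewrite /bil mulmxDr mulmxDl mxE. Qed.
Lemma bil_oppmx q r (M : 'M[R]_(q, r)) x y : bil (- M) x y = - bil M x y.
Proof. by rewrite /bil mulmxN mulNmx mxE. Qed.
Lemma bil_scalemx q r a (M : 'M[R]_(q, r)) x y : bil (a *: M) x y = a * bil M x y.
Proof. by rewrite /bil -scalemxAr -scalemxAl mxE. Qed.

Lemma dotvDl q (x x' y : 'cV[R]_q) : dotv (x + x') y = dotv x y + dotv x' y.
Proof. by rewrite -!bil1 bilDl. Qed.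
Lemma dotvDr q (x y y' : 'cV[R]_q) : dotv x (y + y') = dotv x y + dotv x y'.
Proof. by rewrite -!bil1 bilDr. Qed.
Lemma dotvZl q a (x y : 'cV[R]_q) : dotv (a *: x) y = a * dotv x y.
Proof. by rewrite -!bil1 bilZl. Qed.
Lemma dotvZr q a (x y : 'cV[R]_q) : dotv x (a *: y) = a * dotv x y.
Proof. by rewrite -!bil1 bilZr. Qed.
Lemma dotvNl q (x y : 'cV[R]_q) : dotv (- x) y = - dotv x y.
Proof. by rewrite -!bil1 bilNl. Qed.
Lemma dotvNr q (x y : 'cV[R]_q) : dotv x (- y) = - dotv x y.
Proof. by rewrite -!bil1 bilNr. Qed.

Lemma dotv_ge0 q (x : 'cV[R]_q) : 0 <= dotv x x.
Proof. by rewrite dotvE sumr_ge0// => i _; rewrite -expr2 sqr_ge0. Qed.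

Lemma dotv_eq0 q (x : 'cV[R]_q) : (dotv x x == 0) = (x == 0).
Proof.
apply/eqP/eqP => [|->]; last by rewrite /dotv mulmx0 mxE.
rewrite dotvE => /psumr_eq0P H; apply/matrixP => i j; rewrite ord1 mxE.
have /eqP := H (fun i _ => sqr_ge0 (x i 0)) i isT.
by rewrite -expr2 sqrf_eq0 => /eqP.
Qed.

Lemma dotv_gt0 q (x : 'cV[R]_q) : (0 < dotv x x) = (x != 0).
Proof. by rewrite lt_neqAle eq_sym dotv_ge0 andbT dotv_eq0. Qed.

Lemma vnormE q (x : 'cV[R]_q) : vnorm x = Num.sqrt (dotv x x).
Proof. by rewrite /vnorm dotvE; congr Num.sqrt; apply: eq_bigr => i _; rewrite expr2. Qed.

Lemma vnorm_ge0 q (x : 'cV[R]_q) : 0 <= vnorm x.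
Proof. exact: sqrtr_ge0. Qed.

Lemma sqr_vnorm q (x : 'cV[R]_q) : vnorm x ^+ 2 = dotv x x.
Proof. by rewrite vnormE sqr_sqrtr ?dotv_ge0. Qed.

Lemma vnorm_gt0 q (x : 'cV[R]_q) : (0 < vnorm x) = (x != 0).
Proof. by rewrite vnormE sqrtr_gt0 dotv_gt0. Qed.

Lemma vnormZ q a (x : 'cV[R]_q) : vnorm (a *: x) = `|a| * vnorm x.
Proof. by rewrite !vnormE dotvZl dotvZr mulrA -expr2 sqrtrM ?sqr_ge0// sqrtr_sqr. Qed.

Lemma vnorm_unit q (x : 'cV[R]_q) : x != 0 -> vnorm ((vnorm x)^-1 *: x) = 1.
Proof.
rewrite -vnorm_gt0 => x0; rewrite vnormZ ger0_norm ?invr_ge0 ?(ltW x0)//.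
by rewrite mulVf ?gt_eqF.
Qed.

(** The discriminant argument works if one diagonal value is positive; if both vanish, positivity at
    [x + y] and [x - y] forces [bil M x y = 0]. *)
Lemma psd_cauchy_schwarz q (M : 'M[R]_q) x y : M^T = M -> (forall z, 0 <= bil M z z) ->
  bil M x y ^+ 2 <= bil M x x * bil M y y.
Proof.
move=> MT M0.
have sym : bil M y x = bil M x y by rewrite -{1}MT bil_tr.
have key u v : bil M v u = bil M u v ->
    0 <= bil M u u * (bil M u u * bil M v v - bil M u v ^+ 2).
  move=> uv; have := M0 (bil M u u *: v + - (bil M u v *: u)).
  by rewrite !(bilDl, bilDr, bilNl, bilNr, bilZl, bilZr) uv; congr (_ <= _); ring.
have k1 := key x y sym; have k2 := key y x (esym sym); rewrite sym in k2.
have p1 := M0 (x + y); have p2 := M0 (x + - y).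
rewrite !(bilDl, bilDr, bilNl, bilNr) sym in p1 p2.
have x0 := M0 x; have y0 := M0 y.
move: k1 k2 p1 p2 x0 y0; set a := bil M x x; set b := bil M x y; set c := bil M y y.
move=> k1 k2 p1 p2 a0 c0.
have [a1|a1] := ltrP 0 a; first by move: k1; rewrite pmulr_rge0// subr_ge0.
have [c1|c1] := ltrP 0 c; first by move: k2; rewrite pmulr_rge0// subr_ge0 mulrC.
have a2 : a = 0 by apply/eqP; rewrite eq_le a1.
have c2 : c = 0 by apply/eqP; rewrite eq_le c1.
have b2 : b = 0 by rewrite a2 c2 in p1 p2; lra.
by rewrite a2 b2 expr0n mul0r.
Qed.

Lemma cauchy_schwarz q (x y : 'cV[R]_q) : dotv x y ^+ 2 <= dotv x x * dotv y y.
Proof.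
rewrite -!bil1; apply: psd_cauchy_schwarz; first exact: trmx1.
by move=> z; rewrite bil1 dotv_ge0.
Qed.

Lemma dotv_le q (x y : 'cV[R]_q) : dotv x y <= vnorm x * vnorm y.
Proof.
rewrite !vnormE -sqrtrM ?dotv_ge0//; apply: le_trans (ler_norm _) _.
by rewrite -sqrtr_sqr ler_wsqrtr// cauchy_schwarz.
Qed.

Lemma vnormD q (x y : 'cV[R]_q) : vnorm (x + y) <= vnorm x + vnorm y.
Proof.
rewrite -(ler_pXn2r (_ : 0 < 2)%N) ?nnegrE ?addr_ge0 ?vnorm_ge0//.
rewrite sqr_vnorm !(dotvDl, dotvDr) sqrrD -!sqr_vnorm (dotvC y x).
by have := dotv_le x y; lra.
Qed.

Lemma vnormN q (x : 'cV[R]_q) : vnorm (- x) = vnorm x.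
Proof. by rewrite -scaleN1r vnormZ normrN normr1 mul1r. Qed.

Lemma vnorm0 q : vnorm (0 : 'cV[R]_q) = 0.
Proof. by rewrite vnormE /dotv mulmx0 mxE sqrtr0. Qed.

Lemma abs_dotv_le q (x y : 'cV[R]_q) : `|dotv x y| <= vnorm x * vnorm y.
Proof.
rewrite ler_norml dotv_le andbT lerNl -dotvNl.
by apply: le_trans (dotv_le _ _) _; rewrite vnormN.
Qed.

Lemma vnorm_mulmx_frob q r (M : 'M[R]_(q, r)) (x : 'cV[R]_r) :
  vnorm (M *m x) <= Num.sqrt (frob2 M) * vnorm x.
Proof.
rewrite vnormE (vnormE x) -sqrtrM; last first.
  by apply: sumr_ge0 => i _; apply: sumr_ge0 => j _; exact: sqr_ge0.
rewrite ler_wsqrtr// dotvE /frob2 big_distrl/=; apply: ler_sum => i _.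
have -> : (M *m x) i 0 = dotv (row i M)^T x.
  by rewrite mxE dotvE; apply: eq_bigr => j _; rewrite !mxE.
rewrite -expr2; apply: le_trans (cauchy_schwarz _ _) _.
rewrite ler_wpM2r ?dotv_ge0// dotvE; apply: ler_sum => j _.
by rewrite !mxE expr2.
Qed.

Section Opnorm.
Variables (q r : nat) (M : 'M[R]_(q, r)).
Let S := [set vnorm (M *m x) | x in [set x : 'cV[R]_r | vnorm x = 1]].

Let ubS : has_ubound S.
Proof.
exists (Num.sqrt (frob2 M)) => _ [x /= x1 <-].
by rewrite (le_trans (vnorm_mulmx_frob _ _))// x1 mulr1.
Qed.

Lemma opnorm_ge0 : 0 <= opnorm M.
Proof.
have [[y [x x1 xy]]|S0] := pselect (S !=set0).
  apply: le_trans (vnorm_ge0 (M *m x)) _.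
  by apply: ub_le_sup => //; exists x.
(* Without unit vectors ([r = 0]) the supremum takes its default value 0. *)
by rewrite /opnorm -/S sup_out// => -[].
Qed.

Lemma vnorm_mulmx (x : 'cV[R]_r) : vnorm (M *m x) <= opnorm M * vnorm x.
Proof.
have [->|x0] := eqVneq x 0; first by rewrite mulmx0 !vnorm0 mulr0.
have xp : 0 < vnorm x by rewrite vnorm_gt0.
rewrite -ler_pdivrMr// mulrC -[X in X * _]ger0_norm ?invr_ge0 ?(ltW xp)//.
rewrite -vnormZ scalemxAr; apply: ub_le_sup => //.
by exists ((vnorm x)^-1 *: x) => //=; rewrite vnorm_unit.
Qed.

Lemma bil_le_opnorm x y : bil M x y <= opnorm M * (vnorm x * vnorm y).
Proof.
rewrite bil_dot (le_trans (dotv_le _ _))// mulrCA ler_wpM2l ?vnorm_ge0//.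
exact: vnorm_mulmx.
Qed.

Lemma abs_bil_le_opnorm x y : `|bil M x y| <= opnorm M * (vnorm x * vnorm y).
Proof.
rewrite ler_norml bil_le_opnorm andbT lerNl -bilNl.
by rewrite (le_trans (bil_le_opnorm _ _))// vnormN.
Qed.

(** Take for [x] the direction of [M *m y]. *)
Lemma opnorm_le_bil b : 0 <= b ->
  (forall x y, vnorm x = 1 -> vnorm y = 1 -> bil M x y <= b) -> opnorm M <= b.
Proof.
move=> b0 H; have [S0|S0] := pselect (S !=set0); last first.
  by rewrite /opnorm -/S sup_out// => -[].
apply: ge_sup => // _ [y /= y1 <-].
have [->|My] := eqVneq (M *m y) 0; first by rewrite vnorm0.
have := H ((vnorm (M *m y))^-1 *: (M *m y)) y (vnorm_unit My) y1.
by rewrite bilZl bil_dot -sqr_vnorm expr2 mulKf// gt_eqF// vnorm_gt0.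
Qed.

End Opnorm.

(** * Smallest eigenvalue and Rayleigh quotient *)

Section LambdaMin.
Variables (q : nat) (C : 'M[R]_q).
Hypothesis C_sym : C^T = C.

Let S := [set bil C x x | x in [set x : 'cV[R]_q | vnorm x = 1]].
Let nu := inf S.

Let lbS : has_lbound S.
Proof.
exists (- opnorm C) => _ [x /= x1 <-].
have := abs_bil_le_opnorm C x x; rewrite x1 !mulr1 ler_norml => /andP[]; lra.
Qed.

Let nu_le x : nu * dotv x x <= bil C x x.
Proof.
have [->|x0] := eqVneq x 0; first by rewrite /bil /dotv !mulmx0 mxE mulr0.
have xp : 0 < vnorm x by rewrite vnorm_gt0.
rewrite -sqr_vnorm -ler_pdivlMr ?exprn_gt0//.
have : nu <= bil C ((vnorm x)^-1 *: x) ((vnorm x)^-1 *: x).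
  by apply: ge_inf => //; exists ((vnorm x)^-1 *: x) => //=; rewrite vnorm_unit.
by rewrite bilZl bilZr mulrA -expr2 exprVn mulrC.
Qed.

(* If [C - nu] were invertible then it would be bounded below on the unit
   sphere, and the infimum [nu] of the Rayleigh quotient could be increased. *)
Let nu_singular : S !=set0 -> \det (C - nu%:M) = 0.
Proof.
move=> S0; apply/eqP/negPn/negP => dM.
set M := C - nu%:M.
have bM z w : bil M z w = bil C z w - nu * dotv z w.
  by rewrite /M bil_addmx bil_oppmx -scalemx1 bil_scalemx bil1.
have M0 z : 0 <= bil M z z by rewrite bM subr_ge0.
have MT : M^T = M by rewrite /M linearB/= C_sym tr_scalar_mx.
have Mu : M \in unitmx by rewrite unitmxE unitfE.
pose B := opnorm (invmx M) ^+ 2 * opnorm M.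
have B0 : 0 <= B by rewrite mulr_ge0 ?opnorm_ge0// sqr_ge0.
have MB x : dotv x x <= B * bil M x x.
  (* Cauchy-Schwarz for the form [M] at [x] and [M *m x] bounds the square of the left side by
     [bil M x x] times [opnorm M] times the left side. With [invmx M] bounded this makes [M]
     coercive. *)
  have h1 : dotv (M *m x) (M *m x) <= opnorm M * bil M x x.
    have H1 := psd_cauchy_schwarz x (M *m x) MT M0.
    rewrite bil_dotl MT in H1.
    have H2 := bil_le_opnorm M (M *m x) (M *m x); rewrite -expr2 sqr_vnorm in H2.
    have [yp|y0] := ltrP 0 (dotv (M *m x) (M *m x)); last first.
      by rewrite (le_trans y0)// mulr_ge0 ?opnorm_ge0.
    rewrite -(ler_pM2l yp) -expr2; apply: le_trans H1 _.
    by rewrite mulrC mulrA [X in _ <= X * _]mulrC ler_wpM2r.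
  have h2 : vnorm x <= opnorm (invmx M) * vnorm (M *m x).
    by have := vnorm_mulmx (invmx M) (M *m x); rewrite mulKmx.
  rewrite -sqr_vnorm (@le_trans _ _ ((opnorm (invmx M) * vnorm (M *m x)) ^+ 2))//.
    by rewrite lerXn2r ?nnegrE ?mulr_ge0 ?vnorm_ge0 ?opnorm_ge0.
  by rewrite exprMn sqr_vnorm /B -mulrA ler_wpM2l ?sqr_ge0.
have : nu + (B + 1)^-1 <= nu.
  apply: lb_le_inf => // _ [x /= x1 <-].
  have := MB x; rewrite -sqr_vnorm x1 expr1n => H.
  have := bM x x; rewrite -[dotv x x]sqr_vnorm x1 expr1n mulr1 => E.
  have : (B + 1)^-1 <= bil M x x.
    rewrite -[leLHS]mul1r ler_pdivrMr ?ltr_wpDl// mulrDr mulr1 mulrC.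
    by have := M0 x; lra.
  lra.
by rewrite gerDl leNgt invr_gt0 ltr_wpDl.
Qed.

(** No diagonalisation is involved: the infimum [nu] of the Rayleigh quotient bounds all eigenvalues
    from below and, [C - nu] being singular, is itself one of them. *)
Lemma lambda_min_le (x : 'cV[R]_q) : lambda_min C * dotv x x <= bil C x x.
Proof.
have [->|x0] := eqVneq x 0; first by rewrite /bil /dotv !mulmx0 mxE mulr0.
have S0 : S !=set0.
  exists (bil C ((vnorm x)^-1 *: x) ((vnorm x)^-1 *: x)).
  by exists ((vnorm x)^-1 *: x) => //=; rewrite vnorm_unit.
apply: le_trans (nu_le x); rewrite ler_wpM2r ?dotv_ge0//.
apply: ge_inf.
  exists nu => a /eigenvalueP[v vC v0].
  have vT0 : v^T != 0 by rewrite -(inj_eq (@trmx_inj _ _ _)) trmxK trmx0.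
  have := nu_le v^T; rewrite /bil trmxK vC -scalemxAl mxE /dotv trmxK.
  have -> : (v *m v^T) 0 0 = dotv v^T v^T by rewrite /dotv trmxK.
  by rewrite ler_pM2r// dotv_gt0.
have /eqP/det0P[v v0 vM] := nu_singular S0.
apply/eigenvalueP; exists v => //.
by move/eqP: vM; rewrite mulmxBr subr_eq0 mul_mx_scalar => /eqP.
Qed.

End LambdaMin.
End BilinearForms.

(** * Davis-Kahan and K-means *)

Section Clustering.
Variables (R : realType) (K m p : nat) (kG : 'I_p -> 'I_K).
Hypotheses (m0 : (0 < m)%N) (groups : forall k : 'I_K, #|[pred a | kG a == k]| = m).
Let A : 'M[R]_(p, K) := memb R kG.
(** The orthogonal projection onto the range of [A]; the single scalar [m] suffices because all
    groups have the same size. *)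
Let P0 : 'M[R]_p := m%:R^-1 *: (A *m A^T).

Let mR0 : 0 < m%:R :> R. Proof. by rewrite ltr0n. Qed.

Lemma memb_mul (l : 'I_p -> 'I_K) r (Q : 'M[R]_(K, r)) a j :
  (memb R l *m Q) a j = Q (l a) j.
Proof.
rewrite mxE (bigD1 (l a))//= mxE eqxx mul1r big1 ?addr0// => k kl.
by rewrite mxE eq_sym (negbTE kl) mul0r.
Qed.

Lemma memb_gram : A^T *m A = m%:R%:M.
Proof.
apply/matrixP => k l; rewrite !mxE.
under eq_bigr do rewrite !mxE.
have [<-|kl] := eqVneq k l; last first.
  rewrite big1// => a _; have [ak|] := eqVneq (kG a) k; last by rewrite mul0r.
  by rewrite ak (negbTE kl) mulr0.
rewrite -(groups k) -sum1_card natr_sum [RHS]big_mkcond/=; apply: eq_bigr => a _.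
by rewrite inE; case: eqVneq => _; rewrite ?mulr1 ?mulr0.
Qed.

Lemma dotv_memb (v w : 'cV[R]_K) : dotv (A *m v) (A *m w) = m%:R * dotv v w.
Proof.
by rewrite /dotv trmx_mul !mulmxA -(mulmxA v^T) memb_gram mul_mx_scalar -scalemxAl mxE.
Qed.

Let AP0 : A^T *m P0 = A^T.
Proof.
rewrite /P0 -scalemxAr mulmxA memb_gram mul_scalar_mx scalerA mulVf ?scale1r//.
by rewrite gt_eqF.
Qed.

Let P0T : P0^T = P0.
Proof. by rewrite /P0 linearZ/= trmx_mul trmxK. Qed.

Let P0P0 : P0 *m P0 = P0.
Proof. by rewrite {1}/P0 -scalemxAl -mulmxA AP0. Qed.

Let dotv_P0 x y : dotv (P0 *m x) y = dotv (P0 *m x) (P0 *m y).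
Proof. by rewrite -[RHS]bil_dot bil_dotl P0T mulmxA P0P0. Qed.

Lemma pythagoras_P0 x :
  dotv x x = dotv (P0 *m x) (P0 *m x) + dotv (x - P0 *m x) (x - P0 *m x).
Proof.
have h := dotv_P0 x x; rewrite !(dotvDl, dotvDr, dotvNl, dotvNr) (dotvC x (P0 *m x)) h.
ring.
Qed.

Lemma frob2_cols q r (M : 'M[R]_(q, r)) : frob2 M = \sum_j dotv (col j M) (col j M).
Proof.
rewrite /frob2 exchange_big/=; apply: eq_bigr => j _; rewrite dotvE.
by apply: eq_bigr => i _; rewrite !mxE expr2.
Qed.

Lemma frob2_ge0 q r (M : 'M[R]_(q, r)) : 0 <= frob2 M.
Proof. by rewrite frob2_cols sumr_ge0// => j _; exact: dotv_ge0. Qed.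

(** * Leading eigenvectors of the perturbed matrix *)

Section Spectral.
Variables (C : 'M[R]_K) (D : 'M[R]_p) (U : 'M[R]_(p, K)) (lam delta : R).
Hypothesis CL : forall v, lam * dotv v v <= bil C v v.
Hypothesis DD : forall x y, `|bil D x y| <= delta * (vnorm x * vnorm y).
Hypothesis lam0 : 0 < lam.
Hypothesis gap : 2 * delta <= m%:R * lam.
Hypothesis Kp : (K <= p)%N.
Let M := A *m C *m A^T + D.
Hypothesis topU : top_eigvecs M U.

Lemma top_eigvecs_orthonormal : U^T *m U = 1%:M.
Proof.
have [V [mu [OO _ _ UO]]] := topU.
apply/matrixP => k l; have := congr1 (fun B : 'M[R]_p => B (widen_ord Kp k) (widen_ord Kp l)) OO.
rewrite !mxE => H; rewrite -[RHS](_ : (widen_ord Kp k == widen_ord Kp l)%:R = _); last first.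
  by congr (_%:R); congr nat_of_bool; apply/eqP/eqP => [[] /val_inj//|->].
rewrite -H; apply: eq_bigr => a _; rewrite !mxE.
by rewrite (UO a k (widen_ord Kp k))// (UO a l (widen_ord Kp l)).
Qed.

(* Courant-Fischer: the range of [A] has dimension [K], hence meets the
   orthogonal complement of the first [k] eigenvectors. *)
Lemma top_eigenvalue_lower (V : 'M[R]_p) (mu : 'I_p -> R) (k : 'I_p) :
  V^T *m V = 1%:M -> M *m V = V *m diag_mx (\row_j mu j) ->
  (forall i j : 'I_p, (i <= j)%N -> mu j <= mu i) -> (k < K)%N ->
  m%:R * lam - delta <= mu k.
Proof.
move=> OO MO mu_decr kK.
have OOT : V *m V^T = 1%:M by apply: mulmx1C.
(* A vector [v] in the left kernel of [N], nonzero as [k < K], is one for which [A *m v] is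
   orthogonal to the first [k] eigenvectors. *)
pose N : 'M[R]_(K, k) := \matrix_(i, j) (A^T *m V) i (widen_ord (ltnW (ltn_ord k)) j).
have : kermx N != 0.
  rewrite -mxrank_eq0 mxrank_ker subn_eq0 -ltnNge.
  by rewrite (leq_ltn_trans (rank_leq_col _)).
case/rowV0Pn => vT /sub_kermxP vN v0.
pose v := vT^T; have vv0 : 0 < dotv v v.
  by rewrite dotv_gt0 /v -(inj_eq (@trmx_inj _ _ _)) trmxK trmx0.
pose x := A *m v; pose y := V^T *m x.
have xx : dotv x x = m%:R * dotv v v by rewrite dotv_memb.
have yy : dotv y y = dotv x x by rewrite /dotv /y trmx_mul trmxK !mulmxA -(mulmxA x^T) OOT mulmx1.
have y0 (i : 'I_p) : (i < k)%N -> y i 0 = 0.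
  move=> ik; have := congr1 (fun B : 'rV[R]_k => B 0 (Ordinal ik)) vN.
  rewrite mxE [RHS]mxE => H; rewrite -[RHS]H /y /x mulmxA mxE; apply: eq_bigr => j _.
  have ->: N j (Ordinal ik) = (A^T *m V) j i.
    by rewrite mxE; congr ((A^T *m V) _ _); exact: val_inj.
  have -> : vT 0 j = v j 0 by rewrite [RHS]mxE.
  rewrite mulrC; congr (_ * _); rewrite !mxE; apply: eq_bigr => a _.
  by rewrite !mxE mulrC.
have xMx : bil M x x = \sum_i mu i * y i 0 ^+ 2.
  have -> : M = V *m diag_mx (\row_j mu j) *m V^T by rewrite -MO -mulmxA OOT mulmx1.
  have -> : bil (V *m diag_mx (\row_j mu j) *m V^T) x x = bil (diag_mx (\row_j mu j)) y y.
    by rewrite /bil /y (trmx_mul V^T x) trmxK !mulmxA.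
  rewrite bil_dot dotvE; apply: eq_bigr => i _.
  by rewrite mul_diag_mx !mxE; ring.
have hup : bil M x x <= mu k * dotv x x.
  rewrite xMx -yy dotvE mulr_sumr; apply: ler_sum => i _.
  have [ik|ki] := ltnP i k; first by rewrite y0// expr0n mul0r !mulr0.
  by rewrite -expr2 ler_wpM2r ?sqr_ge0// mu_decr.
have low : (m%:R * lam - delta) * dotv x x <= bil M x x.
  rewrite /M bil_addmx.
  have -> : bil (A *m C *m A^T) x x = m%:R ^+ 2 * bil C v v.
    rewrite /bil /x trmx_mul !mulmxA -(mulmxA v^T) memb_gram mul_mx_scalar.
    rewrite -!scalemxAl -(mulmxA (v^T *m C)) memb_gram mul_mx_scalar -scalemxAl.
    by rewrite !mxE expr2 mulrA.
  have := DD x x; rewrite -expr2 sqr_vnorm ler_norml => /andP[d1 _].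
  have : m%:R * lam * dotv x x <= m%:R ^+ 2 * bil C v v.
    rewrite xx (_ : _ * _ = m%:R ^+ 2 * (lam * dotv v v)); last by ring.
    by rewrite ler_wpM2l ?sqr_ge0.
  move: d1; lra.
by have := le_trans low hup; rewrite ler_pM2r// xx mulr_gt0.
Qed.

(** For a leading eigenvector [u], the residual [w = u - P0 *m u] is orthogonal to the range of [A],
    so the signal part vanishes on it and [mu j * dotv w w = bil D w u]. Since [mu j >= m * lam / 2]
    by [gap], each column of [U] is within [2 * delta / (m * lam)] of the range. *)
Lemma davis_kahan : frob2 (U - P0 *m U) <= K%:R * (2 * delta / (m%:R * lam)) ^+ 2.
Proof.
have [V [mu [OO MO mu_decr UO]]] := topU.
have ml0 : 0 < m%:R * lam by rewrite mulr_gt0.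
rewrite frob2_cols mulr_natl -[X in _ *+ X]card_ord -sumr_const.
apply: ler_sum => k _.
pose j := widen_ord Kp k; pose u := col j V.
have colU : col k (U - P0 *m U) = u - P0 *m u.
  have -> : u = col k U by apply/matrixP => a b; rewrite !mxE (UO a k j).
  by rewrite !colE mulmxBl mulmxA.
rewrite colU; set w := u - P0 *m u.
have Mu : M *m u = mu j *: u.
  apply/matrixP => a b.
  have -> : (M *m u) a b = (M *m V) a j.
    by rewrite !mxE; apply: eq_bigr => i _; rewrite !mxE.
  by rewrite MO mul_mx_diag !mxE mulrC.
have muj : m%:R * lam / 2 <= mu j.
  by have := top_eigenvalue_lower OO MO mu_decr (k := j) (ltn_ord k); move: gap; lra.
have u1 : vnorm u = 1.
  rewrite vnormE (_ : dotv u u = (V^T *m V) j j); first by rewrite OO mxE eqxx sqrtr1.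
  by rewrite dotvE [RHS]mxE; apply: eq_bigr => a _; rewrite !mxE.
have P0w : P0 *m w = 0 by rewrite /w mulmxBr mulmxA P0P0 subrr.
have P0w0 z : dotv w (P0 *m z) = 0 by rewrite -bil_dot bil_dotl P0T P0w /dotv linear0 mul0mx mxE.
have ATw : A^T *m w = 0 by rewrite -AP0 -mulmxA P0w mulmx0.
have key : mu j * dotv w w = bil D w u.
  have -> : dotv w w = dotv w u by rewrite {2}/w dotvDr dotvNr P0w0 subr0.
  rewrite -dotvZr -Mu -bil_dot /M bil_addmx.
  have -> : bil (A *m C *m A^T) w u = 0; last by rewrite add0r.
  have wA : w^T *m A = 0 by rewrite -[A]trmxK -trmx_mul ATw trmx0.
  by rewrite /bil !mulmxA wA !mul0mx mxE.
have wD : m%:R * lam / 2 * vnorm w <= delta.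
  have d0 : 0 <= delta by have := DD u u; rewrite u1 !mulr1; apply: le_trans.
  have [->|w0] := eqVneq w 0; first by rewrite vnorm0 mulr0.
  have wp : 0 < vnorm w by rewrite vnorm_gt0.
  rewrite -(ler_pM2r wp) -(mulrA _ (vnorm w)) -expr2 sqr_vnorm.
  apply: (@le_trans _ _ (mu j * dotv w w)); first by rewrite ler_wpM2r// dotv_ge0.
  by rewrite key; have := DD w u; rewrite u1 mulr1; apply: le_trans; exact: ler_norm.
rewrite -sqr_vnorm lerXn2r ?nnegrE ?vnorm_ge0//.
  by rewrite divr_ge0 ?(ltW ml0)//; have := mulr_ge0 (ltW ml0) (vnorm_ge0 w); lra.
by rewrite ler_pdivlMr//; move: wD; lra.
Qed.

End Spectral.

(** * From approximate K-means to the number of misclassified rows *)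

Section Kmeans.
Variables (U : 'M[R]_(p, K)) (eta rho : R) (lab : 'I_p -> 'I_K) (Q : 'M[R]_K).
Hypothesis UU : U^T *m U = 1%:M.
Hypothesis eta0 : 0 < eta.
Hypothesis rho1 : rho < 1.
Hypothesis kmeans : approx_kmeans eta U lab Q.
Let S := frob2 (U - P0 *m U).
Hypothesis S_small : 4 * (1 + Num.sqrt eta) ^+ 2 * S <= rho.
(** Row [k] is the mean of the rows of [U] over group [k], the ideal center of that group. *)
Let q : 'M[R]_K := m%:R^-1 *: (A^T *m U).
Let dist (a : 'I_p) : R := \sum_j (q (kG a) j - Q (lab a) j) ^+ 2.

Let S0 : 0 <= S. Proof. exact: frob2_ge0. Qed.

Let S_half : S <= 2^-1.
Proof.
have h : 1 <= (1 + Num.sqrt eta) ^+ 2 by rewrite expr_ge1// ?lerDl ?addr_ge0 ?sqrtr_ge0.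
by have : 4 * (1 * S) <= 4 * ((1 + Num.sqrt eta) ^+ 2 * S);
  [rewrite ler_pM2l// ler_wpM2r|move: S_small rho1; lra].
Qed.

Let P0U : P0 *m U = A *m q.
Proof. by rewrite /P0 /q -scalemxAl -scalemxAr mulmxA. Qed.

Let kmeans_le : frob2 (U - memb R lab *m Q) <= eta * S.
Proof.
apply: le_trans kmeans _; rewrite ler_wpM2l ?(ltW eta0)//.
apply: ge_inf; first by exists 0 => _ [l [Q' ->]]; exact: frob2_ge0.
by exists kG, q; rewrite /S P0U.
Qed.

(** The triangle inequality in Frobenius norm between the ideal fit, of error [S], and the computed
    fit, of error at most [eta * S]. It is proved entrywise by Young's inequality, with the
    parameter [t = sqrt eta] that reproduces the square. *)
Let dist_sum : \sum_a dist a <= (1 + Num.sqrt eta) ^+ 2 * S.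
Proof.
set t := Num.sqrt eta; have t0 : 0 < t by rewrite sqrtr_gt0.
have -> : (1 + t) ^+ 2 * S = (1 + t) * S + (1 + t^-1) * (eta * S).
  by rewrite -[eta in RHS](sqr_sqrtr (ltW eta0)) -/t; field; rewrite gt_eqF.
apply: (@le_trans _ _ ((1 + t) * S + (1 + t^-1) * frob2 (U - memb R lab *m Q))); last first.
  by rewrite lerD2l ler_wpM2l// addr_ge0// invr_ge0 ltW.
rewrite /S /frob2 !mulr_sumr -big_split/=; apply: ler_sum => a _.
rewrite !mulr_sumr -big_split/=; apply: ler_sum => j _.
have eB (N N' : 'M[R]_(p, K)) : (N - N') a j = N a j - N' a j by rewrite !mxE.
rewrite P0U !eB !memb_mul; set x := U a j - q _ _; set y := U a j - Q _ _.
have -> : q (kG a) j - Q (lab a) j = y - x by rewrite /x /y; ring.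
rewrite -subr_ge0 (_ : _ - _ = t^-1 * (t * x + y) ^+ 2); last by field; rewrite gt_eqF.
by rewrite mulr_ge0 ?sqr_ge0// invr_ge0 ltW.
Qed.

(** [U *m z] has the norm of [z], its projection is [A *m (q *m z)], and what the projection loses
    is at most [S * dotv z z]: up to [S], the matrix [sqrt m * q] is an isometry. *)
Let q_lower (z : 'cV[R]_K) : (1 - S) * dotv z z <= m%:R * dotv (q *m z) (q *m z).
Proof.
have e1 : dotv (U *m z) (U *m z) = dotv z z.
  by rewrite /dotv trmx_mul !mulmxA -(mulmxA z^T) UU mulmx1.
have := pythagoras_P0 (U *m z); rewrite e1 mulmxA P0U -mulmxA dotv_memb => e2.
have : dotv (U *m z - A *m (q *m z)) (U *m z - A *m (q *m z)) <= S * dotv z z.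
  rewrite !mulmxA -P0U -mulmxBl.
  rewrite -!sqr_vnorm -(sqr_sqrtr S0) -exprMn lerXn2r ?nnegrE ?mulr_ge0 ?vnorm_ge0 ?sqrtr_ge0//.
  exact: vnorm_mulmx_frob.
by rewrite e2; lra.
Qed.

Let centers_apart (k l : 'I_K) : k != l -> m%:R^-1 <= \sum_j (q k j - q l j) ^+ 2.
Proof.
move=> kl.
have qu : q \in unitmx.
  rewrite -unitmx_tr unitmxE unitfE; apply/det0P => -[v v0 vq].
  have qv : q *m v^T = 0 by rewrite -[q]trmxK -trmx_mul vq trmx0.
  have := q_lower v^T; rewrite qv [dotv 0 0](_ : _ = 0) ?mulr0; last first.
    by apply/eqP; rewrite dotv_eq0.
  have : 0 < dotv v^T v^T by rewrite dotv_gt0 -(inj_eq (@trmx_inj _ _ _)) trmxK trmx0.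
  by move: S_half; nra.
(* The distance of two rows is the norm of [q^T *m y], whereas [q_lower] concerns [q]. Duality: with
   [q *m z = y] the product of [q^T *m y] and [z] is 2, and [q_lower] gives [dotv z z <= 4 * m], so
   Cauchy-Schwarz yields [1 / m]. *)
pose y : 'cV[R]_K := delta_mx k 0 - delta_mx l 0.
pose z := invmx q *m y; have qz : q *m z = y by rewrite mulKVmx.
have yy : dotv y y = 2.
  rewrite dotvE (bigD1 k)//= (bigD1 l)/=; last by rewrite eq_sym.
  rewrite big1 ?addr0; last first.
    by move=> i /andP[ik il]; rewrite !mxE (negbTE ik) (negbTE il) subr0 mul0r.
  by rewrite !mxE !eqxx (negbTE kl) eq_sym (negbTE kl)/=; ring.
have qy : dotv (q^T *m y) (q^T *m y) = \sum_j (q k j - q l j) ^+ 2.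
  rewrite dotvE; apply: eq_bigr => j _; rewrite expr2.
  suff -> : (q^T *m y) j 0 = q k j - q l j by [].
  rewrite /y mulmxBr !mxE (bigD1 k)//= big1 ?addr0; last first.
    by move=> i ik; rewrite !mxE (negbTE ik) mulr0.
  rewrite (bigD1 l)//= big1 ?addr0; last first.
    by move=> i ik; rewrite !mxE (negbTE ik) mulr0.
  by rewrite !mxE !eqxx !mulr1.
rewrite -qy.
have cs := cauchy_schwarz (q^T *m y) z.
rewrite -bil_dotl bil_dot qz yy in cs.
have := q_lower z; rewrite qz yy => ql.
have zz := dotv_ge0 z; have qq := dotv_ge0 (q^T *m y).
rewrite -[leLHS]mul1r ler_pdivrMr//.
move: cs ql zz qq S_half S0 mR0.
set a := dotv _ _; set b := dotv _ _; set M := m%:R => cs ql b0 a0 Sh Sz M0.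
have b1 : b <= 4 * M by nra.
nra.
Qed.

(** At this threshold two good rows with a common estimated center have ideal centers at squared
    distance strictly below [1 / m], the separation of distinct groups. *)
Let good a := dist a < (4 * m%:R)^-1.

Let good_same a b : good a -> good b -> lab a = lab b -> kG a = kG b.
Proof.
move=> ga gb ab; apply/eqP/negPn/negP => /centers_apart.
have : \sum_j (q (kG a) j - q (kG b) j) ^+ 2 <= 2 * dist a + 2 * dist b.
  rewrite /dist !mulr_sumr -big_split/=; apply: ler_sum => j _.
  rewrite ab; set x := q (kG a) j; set y := q (kG b) j; set z := Q _ _.
  by have := sqr_ge0 (x + y - 2 * z); nra.
move: ga gb; rewrite /good invfM; set M := m%:R^-1; lra.
Qed.

Let bad_card : #|[pred a | ~~ good a]|%:R / m%:R <= rho.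
Proof.
apply: le_trans S_small; rewrite -mulrA.
apply: (@le_trans _ _ ((\sum_a dist a) * 4)); last by rewrite mulrC ler_pM2l.
rewrite ler_pdivrMr// -sum1_card natr_sum mulr_suml big_distrl/= big_mkcond/=.
apply: ler_sum => a _; rewrite inE; case: ifPn => [|_].
  rewrite -leNgt -[leLHS]mul1r ler_pdivrMr ?mulr_gt0//; lra.
by rewrite !mulr_ge0 ?(ltW mR0)//; apply: sumr_ge0 => j _; exact: sqr_ge0.
Qed.

(** As [rho < 1], fewer than [m] rows are bad, so every group has a good representative. By
    [good_same] their labels are distinct and define a permutation, under which only bad rows can be
    misclassified. *)
Lemma kmeans_Lbar : @Lbar R p K m lab kG <= rho.
Proof.
have bad_lt : (#|[pred a | ~~ good a]| < m)%N.
  by rewrite -(ltr_nat R) -[ltRHS]mul1r -ltr_pdivrMr// (le_lt_trans bad_card).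
have ex k : exists a, (kG a == k) && good a.
  apply/existsP; rewrite -[X in is_true X]negbK negb_exists; apply/negP => /forallP H.
  move: bad_lt; rewrite ltnNge -{1}(groups k) subset_leq_card//.
  apply/fintype.subsetP => a; rewrite !inE => ak; move: (H a); by rewrite ak.
pose rep k := xchoose (ex k).
have repP k : kG (rep k) = k /\ good (rep k).
  by have /andP[/eqP] := xchooseP (ex k).
pose s0 k := lab (rep k).
have s_inj : injective s0.
  move=> k l kl; have [e1 g1] := repP k; have [e2 g2] := repP l.
  by rewrite -e1 -e2; exact: good_same.
pose s := perm s_inj.
apply: (@le_trans _ _ (\sum_(k : 'I_K) (#|[pred a | (kG a == k) && (lab a != s k)]|%:R / m%:R))).
  apply: ge_inf; last by exists s.
  exists 0 => _ [s' ->]; apply: sumr_ge0 => k _.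
  by rewrite divr_ge0// ler0n.
rewrite -mulr_suml; apply: le_trans bad_card; rewrite ler_pM2r ?invr_gt0//.
rewrite -natr_sum ler_nat.
apply: (@leq_trans #|[pred a | lab a != s (kG a)]|).
  rewrite -sum1_card (partition_big kG predT)//=; apply: leq_sum => k _.
  rewrite -sum1_card; apply/eq_leq/eq_bigl => a; rewrite !inE.
  by case: eqP => [->|]; rewrite ?andbT ?andbF.
apply: subset_leq_card; apply/fintype.subsetP => a; rewrite !inE; apply: contra => ga.
(* Every label is the label of some representative, so a good row can be compared with the one that
   shares its label. *)
have [l sl] : exists l, lab a = s l.
  by exists ((s^-1)%g (lab a)); rewrite permKV.
have [e2 g2] := repP l.
have : kG a = kG (rep l) by apply: good_same => //; rewrite sl permE.
by rewrite e2 => ->; rewrite sl.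
Qed.

End Kmeans.
End Clustering.

(** * The PAC-Bayes bound *)

Section BiasedSigns.
Variables (R : realType) (J : finType).
Implicit Types (mu : J -> R) (e : {ffun J -> bool}).

Definition pm (b : bool) : R := if b then 1 else -1.

(** The law of independent signs with means [mu j]; [mu = 0] gives uniform signs. *)
Definition sign_weight mu e : R := \prod_j ((1 + mu j * pm (e j)) / 2).

Lemma sum_sign_weight_prod mu (phi : J -> bool -> R) :
  \sum_e sign_weight mu e * \prod_j phi j (e j) =
  \prod_j ((1 + mu j) / 2 * phi j true + (1 - mu j) / 2 * phi j false).
Proof.
transitivity (\prod_j \sum_(b : bool) ((1 + mu j * pm b) / 2 * phi j b)).
  rewrite bigA_distr_bigA; apply: eq_bigr => e _.
  by rewrite /sign_weight -big_split.
by apply: eq_bigr => j _; rewrite big_bool /pm mulr1 mulrN1.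
Qed.

Lemma sum_sign_weight mu : \sum_e sign_weight mu e = 1.
Proof.
have := sum_sign_weight_prod mu (fun _ _ => 1).
rewrite [RHS]big1 => [<-|j _]; last by field.
by apply: eq_bigr => e _; rewrite big1 ?mulr1.
Qed.

Lemma sign_weight_mean mu j : \sum_e sign_weight mu e * pm (e j) = mu j.
Proof.
have := sum_sign_weight_prod mu (fun j' b => if j' == j then pm b else 1).
rewrite [RHS](bigD1 j)//= eqxx [X in _ * X]big1 => [|j' /negbTE ->]; last by field.
rewrite [RHS](_ : _ = mu j); last by rewrite /pm; field.
move=> <-; apply: eq_bigr => e _; congr (_ * _).
by rewrite (bigD1 j)//= eqxx big1 ?mulr1// => j' /negbTE ->.
Qed.

Lemma sign_weight_cov mu j k : \sum_e sign_weight mu e * (pm (e j) * pm (e k)) =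
  mu j * mu k + (j == k)%:R * (1 - mu j ^+ 2).
Proof.
have [<-|jk] := eqVneq j k.
  rewrite mul1r -expr2 addrC subrK -[RHS](sum_sign_weight mu).
  by apply: eq_bigr => e _; rewrite /pm; case: (e j); ring.
rewrite mul0r addr0.
have := sum_sign_weight_prod mu
  (fun j' b => if j' == j then pm b else if j' == k then pm b else 1).
rewrite [RHS](bigD1 j)//= [X in _ * X](bigD1 k)//=; last by rewrite eq_sym.
rewrite !eqxx eq_sym (negbTE jk) [X in _ * (_ * X)]big1 => [|j' /andP[/negbTE -> /negbTE ->]]; last by field.
rewrite [RHS](_ : _ = mu j * mu k); last by rewrite /pm; field.
move=> <-; apply: eq_bigr => e _; congr (_ * _).
rewrite (bigD1 j)//= (bigD1 k)//=; last by rewrite eq_sym.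
rewrite !eqxx eq_sym (negbTE jk) big1 ?mulr1// => j' /andP[/negbTE -> /negbTE ->//].
Qed.

Variable mu : J -> R.
Hypothesis mu1 : forall j, `|mu j| <= 1.

Lemma sign_weight_ge0 e : 0 <= sign_weight mu e.
Proof.
apply: prodr_ge0 => j _; have := mu1 j; rewrite ler_norml => /andP[m1 m2].
by rewrite divr_ge0// /pm; case: (e j); lra.
Qed.

(** From [1 + t <= expR t]: the log-density with respect to uniform signs is at most a linear form
    in the signs, whose mean under the biased law is [\sum_j mu j ^+ 2]. This bounds the relative
    entropy. *)
Lemma sign_weight_le e :
  sign_weight mu e <= 2^-1 ^+ #|J| * expR (\sum_j mu j * pm (e j)).
Proof.
rewrite expR_sum -prodr_const -big_split/=; apply: ler_prod => j _.
have := mu1 j; rewrite ler_norml => /andP[m1 m2]; apply/andP; split.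
  by rewrite divr_ge0// /pm; case: (e j); lra.
by rewrite mulrC ler_pM2l ?invr_gt0// expR_ge1Dx.
Qed.

Lemma sign_weight_entropy :
  \sum_e sign_weight mu e * (\sum_j mu j * pm (e j)) = \sum_j mu j ^+ 2.
Proof.
under eq_bigr do rewrite mulr_sumr.
rewrite exchange_big/=; apply: eq_bigr => j _.
rewrite -[in RHS](sign_weight_mean mu j) expr2 mulr_suml.
under eq_bigr do rewrite mulrCA.
by rewrite -mulr_sumr sign_weight_mean -mulr_suml sign_weight_mean.
Qed.

End BiasedSigns.

(* The finite form of the Donsker-Varadhan inequality: the exponent [l] bounds
   the log-density of the biased signs with respect to the uniform ones. *)
Lemma pac_bayes (R : realType) (J : finType) (mu nu : J -> R)
    (f : {ffun J -> bool} -> {ffun J -> bool} -> R) (b : R) :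
  (forall j, `|mu j| <= 1) -> (forall j, `|nu j| <= 1) ->
  \sum_e \sum_e' (2^-1 ^+ #|J|) ^+ 2 * expR (f e e') <= expR b ->
  \sum_e \sum_e' sign_weight mu e * sign_weight nu e' * f e e' <=
  \sum_j mu j ^+ 2 + \sum_j nu j ^+ 2 + b.
Proof.
move=> mu1 nu1 fb.
pose w := sign_weight mu; pose w' := sign_weight nu.
pose l (e : {ffun J -> bool}) := \sum_j mu j * pm R (e j).
pose l' (e : {ffun J -> bool}) := \sum_j nu j * pm R (e j).
have entl : \sum_e w e * l e = \sum_j mu j ^+ 2 by exact: sign_weight_entropy.
have entl' : \sum_e w' e * l' e = \sum_j nu j ^+ 2 by exact: sign_weight_entropy.
have wl e : w e <= 2^-1 ^+ #|J| * expR (l e) by exact: sign_weight_le.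
have wl' e : w' e <= 2^-1 ^+ #|J| * expR (l' e) by exact: sign_weight_le.
have w1 : \sum_e w e = 1 by exact: sum_sign_weight.
have w1' : \sum_e w' e = 1 by exact: sum_sign_weight.
have w0 e : 0 <= w e by exact: sign_weight_ge0.
have w0' e : 0 <= w' e by exact: sign_weight_ge0.
rewrite -/w -/w' -entl -entl'.
clearbody l l' w w'.
have wlw : \sum_e \sum_e' w e * w' e' * (l e + l' e' + b) =
    \sum_e w e * l e + \sum_e w' e * l' e + b.
  transitivity (\sum_e (w e * l e * (\sum_e' w' e') + w e * (\sum_e' w' e' * l' e')
      + w e * b * (\sum_e' w' e'))).
    apply: eq_bigr => e _; rewrite !mulr_sumr -!big_split/=.
    by apply: eq_bigr => e' _; ring.
  by rewrite !big_split/= -!mulr_suml w1 w1' entl' !mulr1 !mul1r.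
rewrite -wlw -subr_le0 -sumrB.
apply: (@le_trans _ _ (\sum_e \sum_e' ((2^-1 ^+ #|J|) ^+ 2 * expR (f e e') * expR (- b)
    - w e * w' e'))).
  apply: ler_sum => e _; rewrite -sumrB; apply: ler_sum => e' _.
  rewrite -mulrBr.
  have ww : w e * w' e' <= (2^-1 ^+ #|J|) ^+ 2 * expR (l e + l' e').
    apply: le_trans (ler_pM (w0 e) (w0' e') (wl e) (wl' e')) _.
    by rewrite expRD expr2 le_eqVlt; apply/orP; left; apply/eqP; ring.
  (* For [t = f - (l + l' + b)], use [t <= expR t - 1]: the bound on the weights turns
     [w * w' * expR t] into a prior term [expR (f - b)], and the [-1] is summed against total mass
     1. *)
  set t := f e e' - _.
  have te : t <= expR t - 1 by have := expR_ge1Dx t; lra.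
  apply: (@le_trans _ _ (w e * w' e' * (expR t - 1))); first by rewrite ler_wpM2l ?mulr_ge0.
  rewrite mulrBr mulr1 lerD2r.
  apply: (@le_trans _ _ ((2^-1 ^+ #|J|) ^+ 2 * expR (l e + l' e') * expR t)).
    by rewrite ler_wpM2r ?expR_ge0.
  rewrite -!(mulrA (_ ^+ 2)) -!expRD /t le_eqVlt; apply/orP; left; apply/eqP.
  by congr (_ * expR _); ring.
have -> : \sum_e \sum_e' ((2^-1 ^+ #|J|) ^+ 2 * expR (f e e') * expR (- b)
      - w e * w' e') =
    (\sum_e \sum_e' (2^-1 ^+ #|J|) ^+ 2 * expR (f e e')) * expR (- b)
    - (\sum_e w e) * (\sum_e' w' e').
  rewrite [X in _ = X - _]mulr_suml [X in _ = _ - X]mulr_suml -sumrB.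
  by apply: eq_bigr => e _; rewrite mulr_suml [X in _ = _ - X]mulr_sumr -sumrB.
rewrite w1 w1' mulr1 subr_le0.
by rewrite expRN ler_pdivrMr ?expR_gt0// mul1r.
Qed.

(** * Averages of [N] biased sign vectors *)

Section SignAverages.
Variables (R : realType) (p N : nat).
Hypothesis N0 : (0 < N)%N.
Implicit Types (e : {ffun 'I_p * 'I_N -> bool}) (x : 'cV[R]_p).

Let NR0 : 0 < N%:R :> R. Proof. by rewrite ltr0n. Qed.

Definition sign_avg e : 'cV[R]_p := \col_a (N%:R^-1 * \sum_(i < N) pm R (e (a, i))).

Definition avg_weight x e : R := sign_weight (fun j : 'I_p * 'I_N => x j.1 0) e.

Lemma sign_avg_mean x a : \sum_e avg_weight x e * sign_avg e a 0 = x a 0.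
Proof.
under eq_bigr => e _ do rewrite mxE mulrCA mulr_sumr.
rewrite -mulr_sumr exchange_big/=.
under eq_bigr => i _ do rewrite sign_weight_mean/=.
rewrite sumr_const card_ord.
by rewrite -(mulr_natl (x a 0)) mulKf// gt_eqF.
Qed.

Lemma sign_avg_cov x a b : \sum_e avg_weight x e * (sign_avg e a 0 * sign_avg e b 0) =
  x a 0 * x b 0 + (a == b)%:R * (N%:R^-1 * (1 - x a 0 ^+ 2)).
Proof.
transitivity (N%:R^-1 * N%:R^-1 * \sum_(i < N) \sum_(k < N) \sum_e avg_weight x e *
    (pm R (e (a, i)) * pm R (e (b, k)))).
  under [in RHS]eq_bigr => i _ do rewrite exchange_big/=.
  rewrite exchange_big/= mulr_sumr; apply: eq_bigr => e _.
  rewrite !mxE mulrACA big_distrlr/= !mulr_sumr; apply: eq_bigr => i _.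
  by rewrite !mulr_sumr; apply: eq_bigr => k _; ring.
under eq_bigr => i _ do under eq_bigr => k _ do rewrite sign_weight_cov/=.
under eq_bigr => i _ do rewrite big_split/=.
rewrite big_split/=.
have -> : \sum_(i < N) \sum_(k < N) x a 0 * x b 0 = x a 0 * x b 0 * N%:R * N%:R.
  by rewrite !sumr_const card_ord !mulr_natr.
have -> : \sum_(i < N) \sum_(k < N) ((a, i) == (b, k))%:R * (1 - x a 0 ^+ 2) =
    (a == b)%:R * (1 - x a 0 ^+ 2) * N%:R.
  rewrite [RHS]mulr_natr -[in RHS](card_ord N) -sumr_const; apply: eq_bigr => i _.
  rewrite (bigD1 i)//= big1 ?addr0; first by rewrite xpair_eqE eqxx andbT.
  by move=> k ki; rewrite xpair_eqE [i == k]eq_sym (negbTE ki) andbF mul0r.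
by field; rewrite gt_eqF.
Qed.

Lemma sign_avg_quad x (M : 'M[R]_p) :
  \sum_e avg_weight x e * bil M (sign_avg e) (sign_avg e) =
  bil M x x + N%:R^-1 * \sum_a (1 - x a 0 ^+ 2) * M a a.
Proof.
transitivity (\sum_a \sum_b (\sum_e avg_weight x e * (sign_avg e a 0 * sign_avg e b 0)) * M a b).
  under eq_bigr => e _ do rewrite bilE mulr_sumr.
  rewrite exchange_big/=; apply: eq_bigr => a _.
  under eq_bigr => e _ do rewrite mulr_sumr.
  rewrite exchange_big/=; apply: eq_bigr => b _.
  by rewrite mulr_suml; apply: eq_bigr => e _; rewrite mulrA.
under eq_bigr => a _ do under eq_bigr => b _ do rewrite sign_avg_cov mulrDl.
under eq_bigr => a _ do rewrite big_split/=.
rewrite big_split/= -bilE mulr_sumr; congr (_ + _); apply: eq_bigr => a _.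
rewrite (bigD1 a)//= eqxx mul1r big1 ?addr0 ?mulrA//.
by move=> b ba; rewrite eq_sym (negbTE ba) !mul0r.
Qed.

Lemma abs_coord_le x a : vnorm x = 1 -> `|x a 0| <= 1.
Proof.
move=> x1; have : x a 0 ^+ 2 <= 1.
  rewrite -[leRHS](expr1n R 2) -x1 sqr_vnorm dotvE (bigD1 a)//= -expr2 lerDl.
  by apply: sumr_ge0 => i _; rewrite -expr2 sqr_ge0.
by move=> h; rewrite -(@ler_pXn2r _ 2) ?nnegrE// expr1n real_normK ?num_real.
Qed.

(** * Truncated sign averages and the operator norm *)

Section DimensionFree.
Variables (G : 'M[R]_p) (s : R).
Hypotheses (s0 : 0 < s) (Gdiag : forall a, 0 <= G a a).
Hypothesis Gpos : forall x, 0 <= bil G x x.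
Hypothesis Gle : forall x, bil G x x <= s * dotv x x.
Hypothesis Gtr : \tr G <= N%:R * s.

(** The quadratic form of the sign average has mean at most [s + tr G / N <= 2 * s], so by Markov
    the threshold [128 * s] is exceeded with probability at most [1 / 64]. *)
Definition trunc_avg e : 'cV[R]_p :=
  if bil G (sign_avg e) (sign_avg e) <= 128 * s then sign_avg e else 0.

Lemma trunc_avg_le e : bil G (trunc_avg e) (trunc_avg e) <= 128 * s.
Proof.
rewrite /trunc_avg; case: ifP => // _.
by rewrite /bil mulmx0 mxE mulr_ge0// ltW.
Qed.

Let z x : 'cV[R]_p := \sum_e avg_weight x e *: trunc_avg e.

Let avg_weight_ge0 x e : vnorm x = 1 -> 0 <= avg_weight x e.
Proof. by move=> x1; apply: sign_weight_ge0 => j; exact: abs_coord_le. Qed.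

Let dotv_sumr q (I : finType) (w : 'cV[R]_q) (c : I -> R) (v : I -> 'cV[R]_q) :
  dotv w (\sum_i c i *: v i) = \sum_i c i * dotv w (v i).
Proof.
rewrite /dotv mulmx_sumr summxE; apply: eq_bigr => i _.
by rewrite -scalemxAr mxE.
Qed.

Let bil_sumr (B : 'M[R]_p) (I : finType) w (c : I -> R) (v : I -> 'cV[R]_p) :
  bil B w (\sum_i c i *: v i) = \sum_i c i * bil B w (v i).
Proof. by rewrite bil_dotl dotv_sumr; apply: eq_bigr => i _; rewrite bil_dotl. Qed.

Let bil_suml (B : 'M[R]_p) (I : finType) w (c : I -> R) (v : I -> 'cV[R]_p) :
  bil B (\sum_i c i *: v i) w = \sum_i c i * bil B (v i) w.
Proof. by rewrite -bil_tr bil_sumr; apply: eq_bigr => i _; rewrite bil_tr. Qed.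

Lemma sum_avg x : x = \sum_e avg_weight x e *: sign_avg e.
Proof.
apply/matrixP => a b; rewrite ord1 summxE -[LHS]sign_avg_mean.
by apply: eq_bigr => e _; rewrite [RHS]mxE.
Qed.

(* Truncation moves the posterior mean by little: by Cauchy-Schwarz (in AM-GM
   form) against the probability of the truncated event, controlled by Markov. *)
Lemma trunc_mean_close x : vnorm x = 1 -> vnorm (x - z x) <= 4^-1.
Proof.
move=> x1; have [->|d0] := eqVneq (x - z x) 0; first by rewrite vnorm0.
pose w := (vnorm (x - z x))^-1 *: (x - z x); have w1 : vnorm w = 1 by rewrite vnorm_unit.
have xx : dotv x x = 1 by rewrite -sqr_vnorm x1 expr1n.
have -> : vnorm (x - z x) = dotv w (x - z x).
  by rewrite /w dotvZl -sqr_vnorm expr2 mulKf// gt_eqF// vnorm_gt0.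
rewrite dotvDr dotvNr {1}(sum_avg x) !dotv_sumr -sumrB.
pose bad e : R := (128 * s)^-1 * bil G (sign_avg e) (sign_avg e).
have bad0 e : 0 <= bad e.
  by apply: mulr_ge0; [rewrite invr_ge0 mulr_ge0// ltW|exact: Gpos].
pose M := w *m w^T.
have ME v : bil M v v = dotv w v ^+ 2.
  rewrite /bil /M !mulmxA -mulmxA mxE big_ord1 expr2.
  by congr (_ * _); rewrite -/(dotv v w) dotvC.
have coord a : 0 <= 1 - x a 0 ^+ 2 <= 1.
  have h : x a 0 ^+ 2 <= 1.
    by rewrite -real_normK ?num_real// expr_le1// abs_coord_le.
  by rewrite subr_ge0 h lerBlDr lerDl sqr_ge0.
have bound (B : 'M[R]_p) : (forall a, 0 <= B a a) ->
    \sum_e avg_weight x e * bil B (sign_avg e) (sign_avg e) <= bil B x x + N%:R^-1 * \tr B.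
  move=> B0; rewrite sign_avg_quad lerD2l ler_wpM2l ?invr_ge0 ?ler0n//.
  apply: ler_sum => a _; have /andP[c0 c1] := coord a.
  by rewrite -[leRHS]mul1r ler_wpM2r.
have b1 : \sum_e avg_weight x e * bad e <= 64^-1.
  under eq_bigr do rewrite mulrCA.
  rewrite -mulr_sumr ler_pdivrMl ?mulr_gt0//.
  apply: le_trans (bound G Gdiag) _.
  have h1 := Gle x; rewrite xx mulr1 in h1.
  have h2 : N%:R^-1 * \tr G <= s by rewrite ler_pdivrMl.
  by lra.
have b2 : \sum_e avg_weight x e * dotv w (sign_avg e) ^+ 2 <= 2.
  under eq_bigr do rewrite -ME.
  apply: le_trans (bound M _) _.
    by move=> a; rewrite mxE big_ord1 [w^T _ _]mxE -expr2 sqr_ge0.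
  have -> : \tr M = 1.
    rewrite /M mxtrace_mulC /mxtrace big_ord1 -[X in X = _]/(dotv w w) -sqr_vnorm w1.
    by rewrite expr1n.
  rewrite ME; have := cauchy_schwarz w x; rewrite xx -[dotv w w]sqr_vnorm w1 expr1n mulr1.
  have : N%:R^-1 <= 1 :> R by rewrite invf_le1// ler1n.
  lra.
(* On the truncated event [bad e >= 1] and [t <= t ^+ 2 / 16 + 4]. The means are then at most
   [2 / 16 + 4 / 64 = 3 / 16]. *)
apply: (@le_trans _ _ (\sum_e avg_weight x e * (16^-1 * dotv w (sign_avg e) ^+ 2 + 4 * bad e))).
  apply: ler_sum => e _; rewrite -mulrBr ler_wpM2l ?avg_weight_ge0//.
  rewrite /trunc_avg; case: ifPn => [_|].
    by rewrite subrr addr_ge0// mulr_ge0// sqr_ge0.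
  rewrite -ltNge => big.
  have : 1 <= bad e by rewrite /bad ler_pdivlMl ?mulr_gt0// mulr1 ltW.
  have -> : dotv w 0 = 0 by rewrite /dotv mulmx0 mxE.
  set t := dotv w _; have := sqr_ge0 (t / 4 - 2); nra.
under eq_bigr do rewrite mulrDr mulrCA (mulrCA _ 4).
rewrite big_split/= -!mulr_sumr; lra.
Qed.

(** Two independent posteriors, of means near [x] and [y], have entropy at most [N] each, so
    [bil B (z x) (z y) <= (2 * N + b) / l]. Replacing [z x], [z y] by [x], [y] costs
    [1/4 + 5/4 * 1/4 = 9/16] of the norm itself, hence the factor [16 / 7]. *)
Lemma dimension_free_opnorm (B : 'M[R]_p) (l b : R) : 0 < l -> 0 <= b ->
  \sum_e \sum_e' (2^-1 ^+ (p * N)) ^+ 2 * expR (l * bil B (trunc_avg e) (trunc_avg e'))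
    <= expR b ->
  opnorm B <= 16 / 7 * ((2 * N%:R + b) / l).
Proof.
move=> l0 b0 Hb.
set c := (2 * N%:R + b) / l.
have c0 : 0 <= c by rewrite divr_ge0 ?(ltW l0)// addr_ge0// mulr_ge0.
have zz x y : vnorm x = 1 -> vnorm y = 1 -> bil B (z x) (z y) <= c.
  move=> x1 y1; rewrite ler_pdivlMr// mulrC.
  have nrm v : vnorm v = 1 -> \sum_(j : 'I_p * 'I_N) v j.1 0 ^+ 2 = N%:R.
    move=> v1; rewrite -(pair_bigA _ (fun a (i : 'I_N) => v a 0 ^+ 2))/=.
    under eq_bigr do rewrite sumr_const card_ord.
    rewrite sumrMnl; have : dotv v v = 1 by rewrite -sqr_vnorm v1 expr1n.
    rewrite dotvE => vv; under eq_bigr do rewrite expr2.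
    by rewrite vv.
  have -> : 2 * N%:R + b = \sum_(j : 'I_p * 'I_N) x j.1 0 ^+ 2 +
      \sum_(j : 'I_p * 'I_N) y j.1 0 ^+ 2 + b by rewrite !nrm//; ring.
  have -> : l * bil B (z x) (z y) = \sum_e \sum_e' avg_weight x e * avg_weight y e' *
      (l * bil B (trunc_avg e) (trunc_avg e')).
    rewrite bil_suml mulr_sumr; apply: eq_bigr => e _; rewrite bil_sumr !mulr_sumr.
    by apply: eq_bigr => e' _; ring.
  apply: pac_bayes => [j|j|]; [exact: abs_coord_le|exact: abs_coord_le|].
  by rewrite card_prod !card_ord.
set beta := opnorm B; have beta0 : 0 <= beta by exact: opnorm_ge0.
suff : beta <= c + 9 / 16 * beta by lra.
apply: opnorm_le_bil; first by apply: addr_ge0 => //; apply: mulr_ge0 => //; rewrite divr_ge0.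
move=> x y x1 y1.
have ex : x = z x + (x - z x) by rewrite addrC subrK.
have ey : y = z y + (y - z y) by rewrite addrC subrK.
have cx := trunc_mean_close x1; have cy := trunc_mean_close y1.
have e1 : bil B x y = bil B (z x) (z y) + bil B (x - z x) y + bil B (z x) (y - z y).
  rewrite {1}ex bilDl {1}ey bilDr; ring.
have h1 := zz x y x1 y1.
have h2 := bil_le_opnorm B (x - z x) y.
have h3 := bil_le_opnorm B (z x) (y - z y).
have nz : vnorm (z x) <= 5 / 4.
  have -> : z x = x + - (x - z x) by rewrite opprB addrC subrK.
  by apply: le_trans (vnormD _ _) _; rewrite vnormN x1; lra.
rewrite y1 mulr1 -/beta in h2; rewrite -/beta in h3.
have h4 : beta * vnorm (x - z x) <= beta * 4^-1 by rewrite ler_wpM2l.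
have h5 : beta * (vnorm (z x) * vnorm (y - z y)) <= beta * (5 / 4 * 4^-1).
  by rewrite ler_wpM2l// ler_pM ?vnorm_ge0.
rewrite e1; lra.
Qed.

End DimensionFree.
End SignAverages.

(** * Noise variances *)

Lemma bil_delta (R : realType) q (M : 'M[R]_q) i j :
  bil M (delta_mx i 0) (delta_mx j 0) = M i j.
Proof. by rewrite /bil trmx_delta -rowE -colE !mxE. Qed.

Section NoiseVariance.
Variables (R : realType) (n p K m : nat) (kG : 'I_p -> 'I_K) (C : 'M[R]_K).
Variables (gam : 'I_K -> R) (X : 'M[R]_(n, p)) (eps s : R).

Definition contrast (a b : 'I_p) : 'cV[R]_p := delta_mx a 0 - delta_mx b 0.

Let Sg := SigmaMod kG C gam.
Let ip a b c d := bil (X^T *m X) (contrast a b) (contrast c d).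
Let g a b c d := bil Sg (contrast a b) (contrast c d).

Hypotheses (n0 : (0 < n)%N) (m3 : (3 <= m)%N).
Hypothesis groups : forall k : 'I_K, #|[pred a | kG a == k]| = m.
Hypotheses (CT : C^T = C) (C0 : forall x, 0 <= bil C x x).
Hypothesis gam0 : forall k, 0 < gam k.
Hypotheses (eps0 : 0 < eps) (eps_half : eps <= 2^-1).
Hypothesis Sg_le : forall x, bil Sg x x <= s * dotv x x.
Hypothesis conc : forall a b c d,
  `|ip a b c d - n%:R * g a b c d| <= eps * n%:R * Num.sqrt (g a b a b * g c d c d).

Let nR0 : 0 < n%:R :> R. Proof. by rewrite ltr0n. Qed.

Lemma bil_contrast (N : 'M[R]_p) a b c d :
  bil N (contrast a b) (contrast c d) = N a c - N a d - N b c + N b d.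
Proof. by rewrite /contrast !(bilDl, bilDr, bilNl, bilNr) !bil_delta; ring. Qed.

Let SgE a b : Sg a b = C (kG a) (kG b) + (a == b)%:R * gam (kG a).
Proof.
rewrite mxE; congr (_ + _); last by rewrite !mxE mulr_natl.
rewrite -mulmxA memb_mul.
have -> : C *m (memb R kG)^T = (memb R kG *m C^T)^T by rewrite trmx_mul trmxK.
by rewrite mxE memb_mul mxE.
Qed.

Let gE a b c d : g a b c d = Sg a c - Sg a d - Sg b c + Sg b d.
Proof. exact: bil_contrast. Qed.

(** The variance of the difference of two latent factors: it measures how much is lost by taking a
    neighbour in the wrong group. *)
Let t2 k l := bil C (delta_mx k 0 - delta_mx l 0) (delta_mx k 0 - delta_mx l 0).

Let bilC_delta k l k' l' : bil C (delta_mx k 0 - delta_mx l 0) (delta_mx k' 0 - delta_mx l' 0) =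
  C k k' - C k l' - C l k' + C l l'.
Proof. by rewrite !(bilDl, bilDr, bilNl, bilNr) !bil_delta; ring. Qed.

Let gvar a b : a != b -> g a b a b = t2 (kG a) (kG b) + gam (kG a) + gam (kG b).
Proof.
move=> ab; rewrite gE !SgE /t2 bilC_delta !eqxx [b == a]eq_sym (negbTE ab).
by rewrite !mul0r !mul1r; ring.
Qed.

Let gvar_gt0 a b : a != b -> 0 < g a b a b.
Proof.
move=> ab; rewrite gvar// -addrA ltr_wpDl// ?addr_gt0//; exact: C0.
Qed.

Let gvar_le a b : a != b -> g a b a b <= 2 * s.
Proof.
move=> ab; apply: le_trans (Sg_le _) _.
have -> : dotv (contrast a b) (contrast a b) = 2; last by rewrite mulrC.
rewrite -bil1 bil_contrast !mxE !eqxx [b == a]eq_sym (negbTE ab) !mulr1n !mulr0n; ring.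
Qed.

Let s_ge0 a : gam (kG a) <= s.
Proof.
have := Sg_le (delta_mx a 0); rewrite -bil1 !bil_delta SgE mxE !eqxx mul1r mulr1.
by have := C0 (delta_mx (kG a) 0); rewrite bil_delta; lra.
Qed.

Let V_sum a b c d :
  \sum_i (X i a - X i b) * ((X i c - X i d) / Num.sqrt (\sum_j (X j c - X j d) ^+ 2)) =
  ip a b c d / Num.sqrt (ip c d c d).
Proof.
have e a' b' c' d' : ip a' b' c' d' = \sum_i (X i a' - X i b') * (X i c' - X i d').
  rewrite /ip bil_contrast !mxE -!sumrB -big_split/=; apply: eq_bigr => i _.
  by rewrite !mxE; ring.
rewrite !e mulr_suml; apply: eq_bigr => i _; rewrite mulrA.
by under [in LHS]eq_bigr do rewrite expr2.
Qed.

Let ratio_le (u D v : R) : 0 < D -> 0 <= v ->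
  (`|u / Num.sqrt D| <= v) = (u ^+ 2 <= v ^+ 2 * D).
Proof.
move=> D0 v0; have sD : 0 < Num.sqrt D by rewrite sqrtr_gt0.
rewrite normrM normfV (gtr0_norm sD) ler_pdivrMr//.
rewrite -(ler_pXn2r (_ : 0 < 2)%N) ?nnegrE ?mulr_ge0 ?(ltW sD)//.
by rewrite exprMn sqr_sqrtr ?(ltW D0)// real_normK// num_real.
Qed.

Let conc2 a b c d : (ip a b c d - n%:R * g a b c d) ^+ 2 <=
  eps ^+ 2 * n%:R ^+ 2 * (g a b a b * g c d c d).
Proof.
have gg u v : 0 <= g u v u v.
  have [->|uv] := eqVneq u v; last exact/ltW/gvar_gt0.
  by rewrite gE; lra.
have := conc a b c d.
rewrite -(ler_pXn2r (_ : 0 < 2)%N) ?nnegrE ?mulr_ge0 ?sqrtr_ge0 ?(ltW eps0)//.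
by rewrite real_normK ?num_real// !exprMn sqr_sqrtr ?mulr_ge0.
Qed.

Let conc_var a b : a != b -> `|ip a b a b - n%:R * g a b a b| <= eps * n%:R * g a b a b.
Proof.
move=> ab; have := conc a b a b.
by rewrite -expr2 sqrtr_sqr (gtr0_norm (gvar_gt0 ab)).
Qed.

Let ip_gt0 a b : a != b -> n%:R * g a b a b / 2 <= ip a b a b <= 3 / 2 * (n%:R * g a b a b).
Proof.
move=> ab; have := conc_var ab; rewrite ler_norml => /andP[h1 h2].
have p0 : 0 < n%:R * g a b a b by rewrite mulr_gt0 ?gvar_gt0.
have h3 : eps * n%:R * g a b a b <= 2^-1 * (n%:R * g a b a b).
  by rewrite -mulrA ler_pM2r.
apply/andP; split; lra.
Qed.

Let v0 k := 2 * eps * Num.sqrt (n%:R * gam k).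
Let v0_ge0 k : 0 <= v0 k.
Proof. by rewrite !mulr_ge0 ?sqrtr_ge0 ?(ltW eps0). Qed.

Let v0_sq k : v0 k ^+ 2 = 4 * eps ^+ 2 * (n%:R * gam k).
Proof. by rewrite !exprMn sqr_sqrtr ?mulr_ge0 ?(ltW (gam0 _))//; ring. Qed.

(** The latent factors cancel in [X_a - X_b] and [c], [d] avoid [a], [b], so the population
    covariance is zero. Only the fluctuation [eps * n * sqrt (2 * gam * g c d c d)] remains, over a
    norm at least [sqrt (n * g c d c d / 2)]: this is [v0]. *)
Let Vab_same_group a b : a != b -> kG a = kG b -> Vab X a b <= v0 (kG a).
Proof.
move=> ab kab; apply: bigmax_le => // c /andP[ca cb].
apply: bigmax_le => // d /andP[da db]; rewrite V_sum.
have [->|cd] := eqVneq c d.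
  have -> : ip a b d d = 0 by rewrite /ip bil_contrast; ring.
  by rewrite mul0r normr0.
have /andP[D1 _] := ip_gt0 cd; have gc := gvar_gt0 cd.
rewrite ratio_le//; last by apply: lt_le_trans D1; rewrite divr_gt0 ?mulr_gt0.
have := conc2 a b c d.
have -> : g a b c d = 0.
  rewrite gE !SgE kab [a == c]eq_sym [a == d]eq_sym [b == c]eq_sym [b == d]eq_sym.
  by rewrite (negbTE ca) (negbTE da) (negbTE cb) (negbTE db); ring.
rewrite mulr0 subr0 => /le_trans; apply.
have -> : g a b a b = 2 * gam (kG a).
  by rewrite gvar// /t2 bilC_delta kab; ring.
rewrite v0_sq.
apply: (@le_trans _ _ (4 * eps ^+ 2 * (n%:R * gam (kG a)) * (n%:R * g c d c d / 2))).
  by rewrite le_eqVlt; apply/orP; left; apply/eqP; field.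
by rewrite ler_wpM2l // -v0_sq sqr_ge0.
Qed.

(** Groups of size at least 3 have a member outside any two indices. *)
Let pick_in_group k a b : exists c, [/\ kG c = k, c != a & c != b].
Proof.
have [c] : exists c, (kG c == k) && (c \notin [set a; b]%SET).
  apply/existsP; rewrite -[X in is_true X]negbK negb_exists; apply/negP => /forallP H.
  have : (#|[pred x | kG x == k]| <= #|[set a; b]%SET|)%N.
    apply/subset_leq_card/fintype.subsetP => c; rewrite inE => ck.
    by move: (H c); rewrite ck/= negbK.
  by rewrite groups cards2; move: m3; case: (a != b) => /=; case: m => [|[|[|]]].
by rewrite !inE negb_or => /andP[/eqP ck /andP[]]; exists c.
Qed.

(** Test the maximum at a [c] in the group of [a] and a [d] in that of [b]: the population
    covariance is exactly [t2] and both contrasts have the same variance [w2]. A small [V] gives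
    [ip <= 3 * eps * n * w2], concentration adds one more, and [w2 <= 2 * s]. *)
Let t2_small a b : a != b -> Vab X a b <= v0 (kG a) -> t2 (kG a) (kG b) <= 8 * eps * s.
Proof.
move=> ab Vle.
have [kab|kab] := eqVneq (kG a) (kG b).
  rewrite kab /t2 subrr; rewrite /bil mulmx0 mxE !mulr_ge0 ?(ltW eps0)//.
  exact: le_trans (ltW (gam0 _)) (s_ge0 a).
have [c [kc ca cb]] := pick_in_group (kG a) a b.
have [d [kd da db]] := pick_in_group (kG b) a b.
have cd : c != d by apply/eqP => cd; move: kab; rewrite -kc -kd cd eqxx.
have V1 : `|ip a b c d / Num.sqrt (ip c d c d)| <= v0 (kG a).
  apply: le_trans Vle; rewrite -V_sum.
  pose G c' d' := `|\sum_i (X i a - X i b) *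
    ((X i c' - X i d') / Num.sqrt (\sum_j (X j c' - X j d') ^+ 2))|.
  pose F c' := \big[Num.max/0]_(d' | (d' != a) && (d' != b)) G c' d'.
  apply: (@le_trans _ _ (F c)).
    by apply: (@le_bigmax_cond _ _ _ 0 d _ (G c)); rewrite da db.
  by apply: (@le_bigmax_cond _ _ _ 0 c _ F); rewrite ca cb.
have /andP[D1 D2] := ip_gt0 cd; have gc := gvar_gt0 cd.
rewrite ratio_le// in V1; last by apply: lt_le_trans D1; rewrite divr_gt0 ?mulr_gt0.
have gabcd : g a b c d = t2 (kG a) (kG b).
  rewrite gE !SgE [a == c]eq_sym [a == d]eq_sym [b == c]eq_sym [b == d]eq_sym.
  rewrite (negbTE ca) (negbTE da) (negbTE cb) (negbTE db) kc kd /t2 bilC_delta.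
  ring.
set w2 := g c d c d in D1 D2 gc.
have w2E : g a b a b = w2 by rewrite /w2 !gvar// kc kd.
have := conc a b c d; rewrite w2E -/w2 gabcd -expr2 sqrtr_sqr (gtr0_norm gc) ler_norml => /andP[h1 _].
have gw : gam (kG a) <= w2.
  rewrite -w2E gvar//; have := C0 (delta_mx (kG a) 0 - delta_mx (kG b) 0).
  by rewrite -/(t2 _ _); have := gam0 (kG b); lra.
have h2 : ip a b c d <= 3 * eps * n%:R * w2.
  have q0 : 0 <= 3 * eps * n%:R * w2 by rewrite !mulr_ge0 ?(ltW eps0) ?(ltW gc).
  apply: le_trans (ler_norm _) _.
  rewrite -(ler_pXn2r (_ : 0 < 2)%N) ?nnegrE// real_normK ?num_real//.
  apply: le_trans V1 _; rewrite v0_sq.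
  have e2 : 0 <= 4 * eps ^+ 2 * n%:R by rewrite mulr_ge0// mulr_ge0// sqr_ge0.
  apply: (@le_trans _ _ (4 * eps ^+ 2 * n%:R * w2 * (3 / 2 * (n%:R * w2)))).
    rewrite [_ * (n%:R * gam _)]mulrA; apply: ler_pM => //.
    - by rewrite mulr_ge0// ltW.
    - by apply: le_trans D1; rewrite divr_ge0 ?mulr_ge0 ?(ltW gc).
    - by rewrite ler_wpM2l.
  rewrite -subr_ge0 (_ : _ - _ = 3 * (eps * n%:R * w2) ^+ 2); last by field.
  by rewrite mulr_ge0 ?sqr_ge0.
have h3 : n%:R * t2 (kG a) (kG b) <= n%:R * (4 * eps * w2) by lra.
rewrite ler_pM2l// in h3; apply: le_trans h3 _.
have := gvar_le cd; rewrite -/w2 => w2s.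
have : 4 * eps * w2 <= 4 * eps * (2 * s) by rewrite ler_wpM2l// mulr_ge0 ?(ltW eps0).
lra.
Qed.

(** The neighbours may lie in other groups, but they do at least as well as members of the group of
    [a], so [t2_small] applies to both. The bias is a latent covariance, at most [8 * eps * s] by
    Cauchy-Schwarz; the fluctuation adds [2 * eps * s]. *)
Lemma Gamhat_close (ne1 ne2 : 'I_p -> 'I_p) a : valid_ne X ne1 ne2 ->
  `|Gamhat X ne1 ne2 a a - gam (kG a)| <= 10 * eps * s.
Proof.
move=> /(_ a) [a1 V1 a2 a12 V2].
have [c1 [k1 c1a _]] := pick_in_group (kG a) a a.
have [c2 [k2 c2a c21]] := pick_in_group (kG a) a (ne1 a).
have t1 : t2 (kG a) (kG (ne1 a)) <= 8 * eps * s.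
  apply: t2_small; first by rewrite eq_sym.
  by apply: le_trans (V1 c1 c1a) _; apply: Vab_same_group; rewrite // eq_sym.
have t2' : t2 (kG a) (kG (ne2 a)) <= 8 * eps * s.
  apply: t2_small; first by rewrite eq_sym.
  by apply: le_trans (V2 c2 c2a c21) _; apply: Vab_same_group; rewrite // eq_sym.
have -> : Gamhat X ne1 ne2 a a = n%:R^-1 * ip a (ne1 a) a (ne2 a).
  rewrite !mxE eqxx mulr1n; congr (_ * _).
  rewrite /ip bil_contrast !mxE -!sumrB -big_split/=; apply: eq_bigr => i _.
  by rewrite !mxE; ring.
set b1 := ne1 a in a1 a12 t1 *; set b2 := ne2 a in a2 a12 t2' *.
pose cov := bil C (delta_mx (kG a) 0 - delta_mx (kG b1) 0) (delta_mx (kG a) 0 - delta_mx (kG b2) 0).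
have gcov : g a b1 a b2 = cov + gam (kG a).
  rewrite gE !SgE eqxx [a == b2]eq_sym (negbTE a1) (negbTE a2) [b1 == b2]eq_sym (negbTE a12).
  by rewrite !mul0r mul1r /cov bilC_delta; ring.
have es0 : 0 <= 8 * eps * s.
  by rewrite !mulr_ge0 ?(ltW eps0)//; exact: le_trans (ltW (gam0 _)) (s_ge0 a).
have cov_le : `|cov| <= 8 * eps * s.
  rewrite -(ler_pXn2r (_ : 0 < 2)%N) ?nnegrE// real_normK ?num_real//.
  apply: le_trans (psd_cauchy_schwarz _ _ CT C0) _.
  by rewrite expr2 ler_pM// C0.
have ab1 : a != b1 by rewrite eq_sym.
have ab2 : a != b2 by rewrite eq_sym.
have w_le : Num.sqrt (g a b1 a b1 * g a b2 a b2) <= 2 * s.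
  have s0 : 0 <= 2 * s by apply: le_trans (gvar_le ab1); exact/ltW/gvar_gt0.
  rewrite -[leRHS](ger0_norm s0) -sqrtr_sqr ler_wsqrtr// expr2.
  by rewrite ler_pM ?gvar_le// ltW// gvar_gt0.
have := conc a b1 a b2; rewrite gcov.
set I := ip _ _ _ _ => h.
have -> : n%:R^-1 * I - gam (kG a) = n%:R^-1 * (I - n%:R * (cov + gam (kG a))) + cov.
  by field; rewrite gt_eqF.
apply: le_trans (ler_normD _ _) _.
have : `|n%:R^-1 * (I - n%:R * (cov + gam (kG a)))| <= eps * (2 * s).
  rewrite normrM ger0_norm ?invr_ge0 ?ler0n// ler_pdivrMl//.
  apply: le_trans h _.
  have en0 : 0 <= eps * n%:R by rewrite mulr_ge0// ltW.
  by have := ler_wpM2l en0 w_le; lra.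
move: cov_le; lra.
Qed.

End NoiseVariance.

(** * The event *)

Lemma polarization (R : realType) q (B : 'M[R]_q) x y : B^T = B ->
  4 * bil B x y = bil B (x + y) (x + y) - bil B (x - y) (x - y).
Proof.
move=> BT; have e : bil B y x = bil B x y by rewrite -{1}BT bil_tr.
by rewrite !(bilDl, bilDr, bilNl, bilNr) e; ring.
Qed.

(** By the arithmetic-geometric mean inequality, this separates the two quadratic forms produced by
    polarization into exponentials of single ones. *)
Lemma expR_sub_le (R : realType) (u v : R) :
  expR (u - v) <= 2^-1 * expR (2 * u) + 2^-1 * expR (- (2 * v)).
Proof.
have -> : expR (- (2 * v)) = expR (- v) ^+ 2 by rewrite -expRM_natl mulrN.
rewrite expRM_natl expRD; have := sqr_ge0 (expR u - expR (- v)); nra.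
Qed.

Lemma bil_add_le (R : realType) q (G : 'M[R]_q) x y : (forall z, 0 <= bil G z z) ->
  bil G (x + y) (x + y) <= 2 * bil G x x + 2 * bil G y y.
Proof.
move=> G0; have := G0 (x - y); rewrite !(bilDl, bilDr, bilNl, bilNr); lra.
Qed.

Lemma abs_bil_diag_le (R : realType) q (dg : 'rV[R]_q) t x y : 0 <= t ->
  (forall a, `|dg 0 a| <= t) -> `|bil (diag_mx dg) x y| <= t * (vnorm x * vnorm y).
Proof.
move=> t0 dt; rewrite bil_dot (le_trans (abs_dotv_le _ _))//.
rewrite mulrCA ler_wpM2l ?vnorm_ge0//.
rewrite -(ler_pXn2r (_ : 0 < 2)%N) ?nnegrE ?mulr_ge0 ?vnorm_ge0//.
rewrite exprMn !sqr_vnorm !dotvE mulr_sumr; apply: ler_sum => a _.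
rewrite mul_diag_mx !mxE -!expr2 exprMn ler_wpM2r ?sqr_ge0//.
by rewrite -real_normK ?num_real// lerXn2r ?nnegrE.
Qed.

Lemma variance_proxy_le (R : realType) (n N l k s t : R) :
  0 < n -> 0 <= k -> 0 <= l -> l * (2048 * s) = k -> n * k ^+ 2 = N ->
  0 <= t -> t <= 512 * s -> 3 * n * (l / 2) ^+ 2 * t ^+ 2 <= N.
Proof.
move=> n0 k0 l0 lk <- t0 ts.
have u1 : l * t <= k / 4 by have := ler_wpM2l l0 ts; rewrite -lk; lra.
have u0 : 0 <= l * t by rewrite mulr_ge0.
have u2 : (l * t) ^+ 2 <= (k / 4) ^+ 2.
  by rewrite lerXn2r ?nnegrE//; lra.
have -> : 3 * n * (l / 2) ^+ 2 * t ^+ 2 = n * (3 / 4 * (l * t) ^+ 2) by field.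
by rewrite ler_pM2l//; have := sqr_ge0 k; move: u2; rewrite exprMn; lra.
Qed.

Section Model.
Context (R : realType).
Variables (K m p n N : nat) (kG : 'I_p -> 'I_K) (C : 'M[R]_K) (gam : 'I_K -> R).
Hypotheses (Cpos : posdef C) (gam0 : forall k, 0 < gam k).
Hypotheses (n0 : (0 < n)%N) (p0 : (0 < p)%N) (N0 : (0 < N)%N).
Let Sg := SigmaMod kG C gam.
Let s := opnorm Sg.
(** The relative error. As [n * kap ^+ 2 = N], exponents of this order make the fluctuation term
    comparable with the entropy [N]. *)
Let kap : R := Num.sqrt (N%:R / n%:R).
Let lam : R := kap / (2048 * s).

Lemma posdef_bil_ge0 x : 0 <= bil C x x.
Proof.
have [->|x0] := eqVneq x 0; first by rewrite /bil mulmx0 mxE.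
rewrite ltW//; have := Cpos.2 x^T; rewrite trmxK; apply.
by rewrite -(inj_eq (@trmx_inj _ _ _)) trmxK trmx0.
Qed.

Lemma SigmaMod_bil x : bil Sg x x =
  bil C ((memb R kG)^T *m x) ((memb R kG)^T *m x) + \sum_a gam (kG a) * x a 0 ^+ 2.
Proof.
rewrite /Sg /SigmaMod bil_addmx; congr (_ + _).
  by rewrite /bil trmx_mul trmxK !mulmxA.
rewrite bil_dot dotvE; apply: eq_bigr => a _.
by rewrite mul_diag_mx !mxE; ring.
Qed.

Lemma SigmaMod_tr : Sg^T = Sg.
Proof.
by rewrite /Sg /SigmaMod linearD/= tr_diag_mx !trmx_mul trmxK Cpos.1 mulmxA.
Qed.

Lemma SigmaMod_bil_ge0 x : 0 <= bil Sg x x.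
Proof.
rewrite SigmaMod_bil addr_ge0 ?posdef_bil_ge0// sumr_ge0// => a _.
by rewrite mulr_ge0 ?sqr_ge0// ltW.
Qed.

Lemma SigmaMod_diag_gt0 a : 0 < Sg a a.
Proof.
rewrite -bil_delta SigmaMod_bil ltr_wpDl ?posdef_bil_ge0// (bigD1 a)//=.
rewrite mxE !eqxx expr1n mulr1 ltr_pwDl// sumr_ge0// => b _.
by rewrite mulr_ge0 ?sqr_ge0// ltW.
Qed.

Lemma SigmaMod_le x : bil Sg x x <= s * dotv x x.
Proof. by rewrite -sqr_vnorm expr2; exact: bil_le_opnorm. Qed.

Lemma opnorm_SigmaMod_gt0 : 0 < s.
Proof.
pose a := Ordinal p0; have := SigmaMod_le (delta_mx a 0).
rewrite bil_delta -bil1 bil_delta [1%:M _ _]mxE eqxx mulr1n mulr1.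
exact/lt_le_trans/SigmaMod_diag_gt0.
Qed.

(** Test [Sg] on the indicator vector of one group, of squared norm [m]. *)
Lemma lambda_min_opnorm (lm : R) : (0 < K)%N -> (0 < m)%N ->
  (forall k : 'I_K, #|[pred a | kG a == k]| = m) ->
  (forall v, lm * dotv v v <= bil C v v) -> m%:R * lm <= s.
Proof.
move=> K0 m0 groups Cl; pose v : 'cV[R]_K := delta_mx (Ordinal K0) 0.
have vv : dotv v v = 1 by rewrite -bil1 bil_delta mxE eqxx.
have := SigmaMod_le (memb R kG *m v).
rewrite (dotv_memb groups) vv mulr1 SigmaMod_bil mulmxA (memb_gram R groups).
rewrite mul_scalar_mx bilZl bilZr => h.
have h2 : 0 <= \sum_a gam (kG a) * (memb R kG *m v) a 0 ^+ 2.
  by rewrite sumr_ge0// => a _; rewrite mulr_ge0 ?sqr_ge0// ltW.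
have mR : 0 < m%:R :> R by rewrite ltr0n.
have h3 : m%:R * (m%:R * lm) <= m%:R * (m%:R * bil C v v).
  by rewrite !ler_pM2l//; have := Cl v; rewrite vv mulr1.
rewrite -(ler_pM2l mR); lra.
Qed.

Lemma effrank_tr : effrank Sg <= N%:R -> \tr Sg <= N%:R * s.
Proof. by rewrite /effrank ler_pdivrMr// opnorm_SigmaMod_gt0. Qed.

Hypothesis lnpN : ln (p%:R : R) <= N%:R.
Hypothesis kap64 : kap <= 64^-1.

Let s0 : 0 < s := opnorm_SigmaMod_gt0.
Let nR0 : 0 < n%:R :> R. Proof. by rewrite ltr0n. Qed.
Let pR0 : 0 < p%:R :> R. Proof. by rewrite ltr0n. Qed.
Let NR0 : 0 < N%:R :> R. Proof. by rewrite ltr0n. Qed.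
Let kap0 : 0 < kap. Proof. by rewrite sqrtr_gt0 divr_gt0. Qed.
Let kap2 : n%:R * kap ^+ 2 = N%:R.
Proof. by rewrite sqr_sqrtr ?divr_ge0// mulrCA divff ?mulr1// gt_eqF. Qed.
Let lam0 : 0 < lam.
Proof.
by apply: divr_gt0; [exact: kap0|apply: mulr_gt0; [rewrite ltr0n|exact: s0]].
Qed.

Let lamE : lam * (2048 * s) = kap.
Proof.
by apply: divfK; apply: lt0r_neq0; apply: mulr_gt0; [rewrite ltr0n|exact: s0].
Qed.

Notation Eps := {ffun 'I_p * 'I_N -> bool}.
Let hv (e : Eps) : 'cV[R]_p := trunc_avg Sg s e.
Let g a b c d := bil Sg (contrast R a b) (contrast R c d).
(* When [a = b] the inverse is [0] and so is the normalised contrast. *)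
Let nc a b : 'cV[R]_p := (Num.sqrt (g a b a b))^-1 *: contrast R a b.

(* The first summand of [J] gives the two vectors that polarize
   [bil B (hv e) (hv e')], the second one does so for pairs of normalised
   contrasts. The factor [2048 = 4 * 512] in [lam] makes [Jl_small] hold, as the
   quadratic form is at most [2 * 128 s + 2 * 128 s] on the former vectors. *)
Let J : finType :=
  ((Eps * Eps * bool) + ('I_p * 'I_p * 'I_p * 'I_p * bool * bool))%type.

Let sgn (b : bool) : R := if b then 1 else -1.

Let Jv (j : J) : 'cV[R]_p := match j with
  | inl (e, e', b) => hv e + sgn b *: hv e'
  | inr (a1, a2, a3, a4, b, _) => nc a1 a2 + sgn b *: nc a3 a4 end.
Let Jl (j : J) : R := match j with
  | inl (_, _, b) => sgn b * (lam / 2)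
  | inr (_, _, _, _, _, b) => sgn b * kap end.
(** Uniform weights on each family: pairs of sign patterns and one polarization sign, then four
    indices, a polarization sign and the sign of the deviation. *)
Let Jc (j : J) : R := match j with
  | inl _ => 2^-1 * (2^-1 ^+ (p * N)) ^+ 2
  | inr _ => 4^-1 * p%:R^-1 ^+ 4 end.

Let sgn_sq b : sgn b ^+ 2 = 1. Proof. by case: b; rewrite /sgn ?sqrrN expr1n. Qed.
Let sgn_norm b : `|sgn b| = 1. Proof. by case: b; rewrite /sgn ?normrN normr1. Qed.

Let bil_sgn (M : 'M[R]_p) b x : bil M (sgn b *: x) (sgn b *: x) = bil M x x.
Proof. by rewrite bilZl bilZr mulrA -expr2 sgn_sq mul1r. Qed.

Let tau_inl x : 0 <= bil Sg (Jv (inl x)) (Jv (inl x)) <= 512 * s.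
Proof.
rewrite SigmaMod_bil_ge0/=; case: x => [[e e'] b] /=.
apply: le_trans (bil_add_le _ _ SigmaMod_bil_ge0) _; rewrite bil_sgn.
have := trunc_avg_le Sg s0 e; have := trunc_avg_le Sg s0 e'.
rewrite -/(hv e) -/(hv e'); lra.
Qed.

Let nc_le a b : bil Sg (nc a b) (nc a b) <= 1.
Proof.
rewrite bilZl bilZr mulrA -expr2 exprVn sqr_sqrtr ?SigmaMod_bil_ge0//.
rewrite -/(g a b a b); have [->|g0] := eqVneq (g a b a b) 0; first by rewrite mulr0.
by rewrite mulVf.
Qed.

Let tau_inr x : 0 <= bil Sg (Jv (inr x)) (Jv (inr x)) <= 4.
Proof.
rewrite SigmaMod_bil_ge0/=; case: x => [[[[[a1 a2] a3] a4] b] b'] /=.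
apply: le_trans (bil_add_le _ _ SigmaMod_bil_ge0) _; rewrite bil_sgn.
have := nc_le a1 a2; have := nc_le a3 a4; lra.
Qed.

Let Jc_ge0 j : 0 <= Jc j.
Proof. by case: j => x /=; rewrite mulr_ge0 ?exprn_ge0 ?invr_ge0 ?ler0n. Qed.

Let Jl_small j : `|Jl j| * bil Sg (Jv j) (Jv j) <= 8^-1.
Proof.
case: j => x.
  have /andP[t0 t1] := tau_inl x.
  have -> : `|Jl (inl x)| = lam / 2.
    by case: x {t0 t1} => [[e e'] b] /=; rewrite normrM sgn_norm mul1r ger0_norm// divr_ge0// ltW.
  apply: (@le_trans _ _ (lam / 2 * (512 * s))); first by rewrite ler_wpM2l// divr_ge0// ltW.
  have -> : lam / 2 * (512 * s) = kap / 8 by rewrite /lam; field; rewrite gt_eqF.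
  by move: kap64; lra.
have /andP[t0 t1] := tau_inr x.
have -> : `|Jl (inr x)| = kap.
  by case: x {t0 t1} => [[[[[a1 a2] a3] a4] b] b'] /=; rewrite normrM sgn_norm mul1r ger0_norm// ltW.
apply: (@le_trans _ _ (kap * 4)); first by rewrite ler_wpM2l// ltW.
by move: kap64; lra.
Qed.

Let Jc_sum : \sum_j Jc j <= 2.
Proof.
rewrite big_sumType/= !sumr_const !card_prod !card_ord card_ffun card_prod !card_ord card_bool.
rewrite -[X in X + _]mulr_natr -[X in _ + X]mulr_natr !natrM natrX.
have e : (2^-1 ^+ (p * N)) ^+ 2 * (2%:R ^+ (p * N) * 2%:R ^+ (p * N)) = 1 :> R.
  by rewrite -expr2 -exprMn -exprMn mulVf ?expr1n.
have e' : p%:R^-1 ^+ 4 * (p%:R * p%:R * p%:R * p%:R) = 1 :> R.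
  by field; rewrite gt_eqF.
rewrite (_ : _ + _ = 2^-1 * 2 * ((2^-1 ^+ (p * N)) ^+ 2 * (2%:R ^+ (p * N) * 2%:R ^+ (p * N)))
  + p%:R^-1 ^+ 4 * (p%:R * p%:R * p%:R * p%:R)); last by field; rewrite gt_eqF.
by rewrite e e' mulr1 mulVf.
Qed.

Lemma good_event d (T : measurableType d) (P : probability T R)
    (Z : 'I_n -> 'I_K -> T -> R) (E : 'I_n -> 'I_p -> T -> R) :
  (forall i, centered_gaussian P (Z i) (fun k l => C k l)) ->
  (forall i, centered_gaussian P (E i) (fun a b => (a == b)%:R * gam (kG a))) ->
  mutually_indep P (fun ib : 'I_n * bool =>
    if ib.2 then sigma_of (Z ib.1) else sigma_of (E ib.1)) ->
  exists A : set T, [/\ measurable A,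
    forall w, A w -> let X := data_matrix kG Z E w in
      let B := X^T *m X - n%:R *: Sg in
      \sum_e \sum_e' (2^-1 ^+ (p * N)) ^+ 2 * expR (lam * bil B (hv e) (hv e'))
        <= expR (2 * N%:R) /\
      forall a1 a2 a3 a4, `|bil B (nc a1 a2) (nc a3 a4)| <= 28 * kap * n%:R &
    ((1 - 2 / p%:R)%:E <= P A)%E].
Proof.
move=> gZ gE ind.
have [A [mA HA PA]] := data_event Cpos gam0 n0 p0 gZ gE ind Jc_ge0 Jl_small Jc_sum.
exists A; split => // w Aw X B.
have BT : B^T = B.
  by rewrite /B linearB/= linearZ/= SigmaMod_tr trmx_mul trmxK.
have qE v : \sum_i ((X *m v) i 0) ^+ 2 = bil B v v + n%:R * bil Sg v v.
  rewrite /B bil_addmx bil_oppmx bil_scalemx subrK bil_dot -mulmxA -bil_dot.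
  by rewrite bil_dotl trmxK dotvE; apply: eq_bigr => i _; rewrite expr2.
pose W j : R := Jc j * expR (Jl j * bil B (Jv j) (Jv j)
   - 3 * n%:R * Jl j ^+ 2 * bil Sg (Jv j) (Jv j) ^+ 2).
have W0 j : 0 <= W j by rewrite mulr_ge0 ?expR_ge0.
have HW : \sum_j W j <= p%:R.
  apply: le_trans (HA w Aw); apply: ler_sum => j _; rewrite ler_wpM2l// ler_expR.
  by rewrite -/X qE -/(bil Sg _ _) le_eqVlt; apply/orP; left; apply/eqP; rewrite /bil -/Sg; ring.
have pN : p%:R <= expR N%:R :> R by rewrite -[leLHS]lnK ?posrE// ler_expR.
rewrite big_sumType/= in HW.
split.
  have W1 : \sum_x W (inl x) <= p%:R.
    by apply: le_trans HW; rewrite lerDl sumr_ge0.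
  have -> : expR (2 * N%:R) = expR N%:R * expR N%:R :> R by rewrite -expRD; congr expR; ring.
  apply: (@le_trans _ _ (expR N%:R * p%:R)); last by rewrite ler_wpM2l ?expR_ge0.
  apply: le_trans (ler_wpM2l (expR_ge0 _) W1).
  rewrite mulr_sumr.
  have -> : \sum_x expR N%:R * W (inl x) =
      \sum_e \sum_e' \sum_b expR N%:R * W (inl (e, e', b)).
    rewrite pair_big/= pair_big/=.
    by apply: eq_bigr => -[[e e'] b] _.
  apply: ler_sum => e _; apply: ler_sum => e' _; rewrite big_bool/=.
  (* The fluctuation term in the exponent of [W] is at most [N], so removing it costs a factor
     [expR N]; the other one in [expR (2 * N)] pays for [p]. *)
  have main b : 2^-1 * (2^-1 ^+ (p * N)) ^+ 2 * expR (sgn b * (lam / 2) *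
       bil B (hv e + sgn b *: hv e') (hv e + sgn b *: hv e')) <= expR N%:R * W (inl (e, e', b)).
    rewrite /W /= [leRHS]mulrCA ler_wpM2l ?mulr_ge0 ?exprn_ge0 ?invr_ge0//.
    rewrite -expRD ler_expR.
    have /andP[t0 t1] := tau_inl (e, e', b); rewrite /= in t0 t1.
    set tau := bil Sg _ _ in t0 t1 *.
    have : 3 * n%:R * (sgn b * (lam / 2)) ^+ 2 * tau ^+ 2 <= N%:R.
      rewrite exprMn sgn_sq mul1r.
      exact: (variance_proxy_le nR0 (ltW kap0) (ltW lam0) lamE kap2 t0 t1).
    lra.
  apply: le_trans (lerD (main true) (main false)).
  rewrite /= !scale1r !scaleN1r.
  have key : expR (lam * bil B (hv e) (hv e')) <=
      2^-1 * expR (1 * (lam / 2) * bil B (hv e + hv e') (hv e + hv e')) +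
      2^-1 * expR (-1 * (lam / 2) * bil B (hv e - hv e') (hv e - hv e')).
    have -> : lam * bil B (hv e) (hv e') = lam / 4 * bil B (hv e + hv e') (hv e + hv e')
        - lam / 4 * bil B (hv e - hv e') (hv e - hv e').
      by rewrite -mulrBr -polarization//; field.
    apply: le_trans (expR_sub_le _ _) _; rewrite le_eqVlt; apply/orP; left; apply/eqP.
    by congr (_ * expR _ + _ * expR _); field.
  have c0 : 0 <= (2^-1 ^+ (p * N)) ^+ 2 :> R by exact: sqr_ge0.
  have := ler_wpM2l c0 key; rewrite mulrDr.
  by rewrite !(mulrA _ 2^-1) (mulrC _ 2^-1).
have each y : W (inr y) <= p%:R.
  apply: le_trans HW; rewrite (bigD1 y)//= addrCA lerDl addr_ge0// sumr_ge0//.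
have q_le a1 a2 a3 a4 b b' :
    sgn b' * bil B (nc a1 a2 + sgn b *: nc a3 a4) (nc a1 a2 + sgn b *: nc a3 a4) <= 55 * (kap * n%:R).
  have := each (a1, a2, a3, a4, b, b'); rewrite /W.
  have /andP[t0 t1] := tau_inr (a1, a2, a3, a4, b, b').
  set tau := bil Sg _ _ in t0 t1 *; rewrite /=.
  set Q := bil B _ _.
  rewrite -ler_pdivlMl; last by rewrite mulr_gt0 ?invr_gt0 ?exprn_gt0 ?invr_gt0.
  have -> : (4^-1 * p%:R^-1 ^+ 4)^-1 * p%:R = 4 * p%:R ^+ 5 :> R by field; rewrite gt_eqF.
  (* [p <= expR N] gives the fifth power, and [2 <= 1 + N <= expR N] pays for [4]. With the
     fluctuation [3 * 4 ^+ 2 * N = 48 * N] the total is [55 * N]; polarization then gives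
     [55 / 2 <= 28]. *)
  have h4 : 4 * p%:R ^+ 5 <= expR (7 * N%:R) :> R.
    have -> : expR (7 * N%:R) = expR (2 * N%:R) * expR N%:R ^+ 5 :> R.
      by rewrite -expRM_natl -expRD; congr expR; ring.
    apply: ler_pM; [by []|by apply: exprn_ge0| |by rewrite lerXn2r ?nnegrE ?expR_ge0].
    rewrite expRM_natl (_ : 4 = 2 ^+ 2); last by ring.
    rewrite lerXn2r ?nnegrE ?expR_ge0//.
    have N1 : 1 <= N%:R :> R by rewrite ler1n.
    by have := expR_ge1Dx (N%:R : R); lra.
  move=> /le_trans /(_ h4); rewrite ler_expR => h5.
  have h6 : 3 * n%:R * (sgn b' * kap) ^+ 2 * tau ^+ 2 <= 48 * N%:R.
    rewrite exprMn sgn_sq mul1r -(mulrA 3) kap2.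
    have : tau ^+ 2 <= 4 ^+ 2 by rewrite lerXn2r ?nnegrE.
    by move=> h; have := ler_wpM2l (mulr_ge0 (ler0n R 3) (ltW NR0)) h; lra.
  have h7 : kap * (sgn b' * Q) <= 55 * N%:R by lra.
  rewrite -(ler_pM2l kap0) (le_trans h7)// -kap2.
  by rewrite le_eqVlt; apply/orP; left; apply/eqP; ring.
move=> a1 a2 a3 a4.
have := polarization (nc a1 a2) (nc a3 a4) BT.
have := q_le a1 a2 a3 a4 true true; have := q_le a1 a2 a3 a4 true false.
have := q_le a1 a2 a3 a4 false true; have := q_le a1 a2 a3 a4 false false.
rewrite /sgn !scale1r !scaleN1r !mul1r !mulN1r ler_norml.
have := mulr_gt0 kap0 nR0.
move=> h0 h1 h2 h3 h4 h5; apply/andP; split; lra.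
Qed.

End Model.

(** * Recovery *)

(** From [ln p >= 1 - 1 / p]; it keeps the rounding of [max Re (ln p)] to an integer within a
    constant factor. *)
Lemma ln_ge (R : realType) (p : nat) : (3 <= p)%N -> 2 / 3 <= ln (p%:R : R).
Proof.
move=> p3; have p0 : 0 < p%:R :> R by rewrite ltr0n (leq_trans _ p3).
have p3R : 3 <= p%:R :> R by rewrite (ler_nat R 3 p).
have pi : p%:R^-1 <= 3^-1 :> R by rewrite lef_pV2 ?posrE//; lra.
have pi0 : 0 < p%:R^-1 :> R by rewrite invr_gt0.
have H : -1 < p%:R^-1 - 1 :> R by lra.
have := le_ln1Dx H; rewrite (_ : 1 + (p%:R^-1 - 1) = p%:R^-1); last by ring.
by rewrite lnV ?posrE//; lra.
Qed.

(** Read [k = sqrt K], [r = sqrt rho], [M = m], [q = sqrt eta], [l = lambda_min C], and [D * k0 * s]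
    as the perturbation bound. The outputs are the smallness of the error rate, the spectral gap and
    the smallness demanded by K-means. *)
Lemma recovery_constants (R : realType) (D k0 s k r M l q : R) :
  0 < D -> 0 < k0 -> 0 < s -> 1 <= k -> 0 < r -> r <= 1 -> 0 < M -> 0 <= q ->
  4 * D * (1 + q) * k * s / (M * r) * k0 <= l -> M * l <= s ->
  [/\ 0 < l, 4 * D * k0 <= 1, 2 * (D * k0 * s) <= M * l &
    4 * (1 + q) ^+ 2 * (k ^+ 2 * (2 * (D * k0 * s) / (M * l)) ^+ 2) <= r ^+ 2].
Proof.
move=> D0 k00 s0 k1 r0 r1 M0 q0 H Ml.
have kp : 0 < k by lra.
have q1 : 0 < 1 + q by lra.
have l0 : 0 < l by apply: lt_le_trans H; rewrite !(mulr_gt0, invr_gt0)//.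
have H1 : 4 * D * (1 + q) * k * s * k0 <= M * l * r.
  by move: H; rewrite mulrAC ler_pdivrMr ?mulr_gt0//; lra.
set u := D * k0 * s; have u0 : 0 < u by rewrite /u !mulr_gt0.
have H2 : 4 * (1 + q) * k * u <= M * l * r by rewrite /u; lra.
have Ml0 : 0 < M * l by rewrite mulr_gt0.
have q1k : 1 <= (1 + q) * k by have := mulr_ge0 q0 (ltW kp); lra.
have H3 : 4 * u <= M * l.
  apply: (@le_trans _ _ (M * l * r)); last by rewrite -[leRHS]mulr1 ler_pM2l.
  apply: le_trans H2; rewrite (_ : 4 * (1 + q) * k * u = (1 + q) * k * (4 * u)); last by ring.
  by rewrite -[leLHS]mul1r ler_wpM2r// mulr_ge0// ltW.
split => //.
- by rewrite -(ler_pM2r s0) mul1r; apply: le_trans Ml; rewrite /u in H3; lra.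
- lra.
have E : 4 * (1 + q) ^+ 2 * (k ^+ 2 * (2 * u / (M * l)) ^+ 2) =
    (4 * (1 + q) * k * u / (M * l)) ^+ 2.
  by field; rewrite !gt_eqF.
rewrite E lerXn2r ?nnegrE ?(ltW r0)//.
  apply: divr_ge0; last exact: ltW.
  by apply: mulr_ge0; [apply: mulr_ge0; [apply: mulr_ge0|]|]; rewrite ?(ltW q1) ?(ltW kp) ?(ltW u0).
by rewrite ler_pdivrMr//; move: H2; rewrite (mulrC r).
Qed.

Section Recovery.
Context (R : realType).
Variables (K m p n N : nat) (kG : 'I_p -> 'I_K) (C : 'M[R]_K) (gam : 'I_K -> R).
Variables (eta rho k0 : R) (X : 'M[R]_(n, p)).
Let Sg := SigmaMod kG C gam.
Let s := opnorm Sg.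
Let kap : R := Num.sqrt (N%:R / n%:R).
Let lam : R := kap / (2048 * s).
Let B := X^T *m X - n%:R *: Sg.
Let nc a b := (Num.sqrt (bil Sg (contrast R a b) (contrast R a b)))^-1 *: contrast R a b.
Hypotheses (K0 : (0 < K)%N) (m3 : (3 <= m)%N) (pE : p = (K * m)%N) (n0 : (0 < n)%N).
Hypotheses (N0 : (0 < N)%N) (Cpos : posdef C) (gam0 : forall k, 0 < gam k).
Hypothesis groups : forall k : 'I_K, #|[pred a | kG a == k]| = m.
Hypothesis trN : effrank Sg <= N%:R.
Hypothesis kap64 : kap <= 64^-1.
Hypothesis mgf_event : \sum_e \sum_e' (2^-1 ^+ (p * N)) ^+ 2 *
  expR (lam * bil B (trunc_avg (N:=N) Sg s e) (trunc_avg (N:=N) Sg s e')) <= expR (2 * N%:R).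
Hypothesis contrast_event :
  forall a1 a2 a3 a4, `|bil B (nc a1 a2) (nc a3 a4)| <= 28 * kap * n%:R.

Let p0 : (0 < p)%N. Proof. by rewrite pE muln_gt0 K0 (leq_trans _ m3). Qed.
Let s0 : 0 < s := opnorm_SigmaMod_gt0 kG Cpos gam0 p0.
Let nR0 : 0 < n%:R :> R. Proof. by rewrite ltr0n. Qed.
Let NR0 : 0 < N%:R :> R. Proof. by rewrite ltr0n. Qed.
Let kap0 : 0 < kap. Proof. by rewrite sqrtr_gt0 divr_gt0. Qed.
Let kap2 : n%:R * kap ^+ 2 = N%:R.
Proof. by rewrite sqr_sqrtr ?divr_ge0// mulrCA divff ?mulr1// gt_eqF. Qed.
Let lam0 : 0 < lam.
Proof.
by apply: divr_gt0; [exact: kap0|apply: mulr_gt0; [rewrite ltr0n|exact: s0]].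
Qed.

Lemma sample_cov_opnorm : opnorm B <= n%:R * (20000 * kap * s).
Proof.
have NN0 : 0 <= 2 * N%:R :> R by rewrite mulr_ge0.
have := dimension_free_opnorm N0 s0 (fun a => ltW (SigmaMod_diag_gt0 kG Cpos gam0 a))
  (SigmaMod_bil_ge0 kG Cpos gam0) (SigmaMod_le kG C gam)
  (effrank_tr Cpos gam0 p0 trN) lam0 NN0 mgf_event.
move/le_trans; apply.
(* [N / lam = n * kap * 2048 * s], and [64 / 7 * 2048] is below [20000]. *)
have -> : 16 / 7 * ((2 * N%:R + 2 * N%:R) / lam) = n%:R * (64 / 7 * 2048 * kap * s).
  rewrite -kap2 /lam; field; apply/andP; split; apply: lt0r_neq0; [exact: s0|exact: kap0].
rewrite ler_pM2l//.
by have := mulr_gt0 kap0 s0; lra.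
Qed.

(** The noise makes [Sg] definite; hence a contrast with zero normalisation is itself zero and is
    still recovered from [nc]. *)
Lemma bil_SigmaMod_eq0 x : bil Sg x x = 0 -> x = 0.
Proof.
rewrite SigmaMod_bil => /eqP; rewrite paddr_eq0 ?posdef_bil_ge0//; last first.
  by apply: sumr_ge0 => a _; rewrite mulr_ge0 ?sqr_ge0// ltW.
case/andP => _ /eqP/psumr_eq0P H; apply/matrixP => a b; rewrite ord1 mxE.
have /eqP := H (fun a _ => mulr_ge0 (ltW (gam0 _)) (sqr_ge0 _)) a isT.
by rewrite mulf_eq0 gt_eqF//= sqrf_eq0 => /eqP.
Qed.

Lemma contrast_conc a b c d : `|bil (X^T *m X) (contrast R a b) (contrast R c d) -
    n%:R * bil Sg (contrast R a b) (contrast R c d)| <=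
  28 * kap * n%:R * Num.sqrt (bil Sg (contrast R a b) (contrast R a b) *
    bil Sg (contrast R c d) (contrast R c d)).
Proof.
have -> : bil (X^T *m X) (contrast R a b) (contrast R c d) -
    n%:R * bil Sg (contrast R a b) (contrast R c d) = bil B (contrast R a b) (contrast R c d).
  by rewrite [RHS]bil_addmx [X in _ = _ + X]bil_oppmx bil_scalemx.
pose w a b := Num.sqrt (bil Sg (contrast R a b) (contrast R a b)).
have G0 := SigmaMod_bil_ge0 kG Cpos gam0.
have e u v : contrast R u v = w u v *: nc u v.
  have [w0|w0] := eqVneq (w u v) 0; last by rewrite /nc scalerA mulfV ?scale1r.
  rewrite w0 scale0r; apply: bil_SigmaMod_eq0; apply/eqP.
  by rewrite eq_le G0 andbT -sqrtr_eq0; apply/eqP.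
rewrite sqrtrM ?G0// -/(w a b) -/(w c d) {1}(e a b) {1}(e c d) bilZl bilZr mulrA normrM.
rewrite [leRHS]mulrC ger0_norm ?mulr_ge0 ?sqrtr_ge0// ler_wpM2l ?mulr_ge0 ?sqrtr_ge0//.
Qed.

(* With [kap <= 2 * k0], the constant [42 * 1000] dominates [2 * (20000 + 10 * 28)], the
   contributions of the sample covariance and of the noise variances. *)
Lemma CSC_Lbar lab : 1 < eta -> 0 < rho < 1 -> 0 < k0 -> kap <= 2 * k0 ->
  4 * (42 * 1000) * (1 + Num.sqrt eta) * Num.sqrt K%:R * s / (m%:R * Num.sqrt rho) * k0
    <= lambda_min C ->
  CSC_output eta X lab -> @Lbar R p K m lab kG <= rho.
Proof.
move=> eta1 /andP[rho0 rho1] k00 kk0 Hl [ne1 [ne2 [U [Q [val top km]]]]].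
have m0 : (0 < m)%N by apply: leq_trans m3.
have CL := lambda_min_le Cpos.1.
have Ml := lambda_min_opnorm gam0 K0 m0 groups CL.
have [D [D0 DE]] : exists D : R, 0 < D /\ D = 42 * 1000.
  by exists (42 * 1000); rewrite mulr_gt0 ?ltr0n.
rewrite -DE in Hl.
have K1 : 1 <= Num.sqrt K%:R :> R by rewrite -[leLHS]sqrtr1 ler_wsqrtr// ler1n.
have r0 : 0 < Num.sqrt rho by rewrite sqrtr_gt0.
have r1 : Num.sqrt rho <= 1 by rewrite -[leRHS]sqrtr1 ler_wsqrtr// ltW.
have mR : 0 < m%:R :> R by rewrite ltr0n.
have [l0 _ gap S_small] := recovery_constants D0 k00 s0 K1 r0 r1 mR (sqrtr_ge0 eta) Hl Ml.
rewrite !sqr_sqrtr ?ler0n ?(ltW rho0)// in S_small.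
pose A := memb R kG.
pose Dl := Sighat X - Gamhat X ne1 ne2 - A *m C *m A^T.
have eps0 : 0 < 28 * kap by rewrite mulr_gt0.
have eps_half : 28 * kap <= 2^-1 by move: kap64; lra.
have Gh a := Gamhat_close n0 m3 groups Cpos.1 (posdef_bil_ge0 Cpos) gam0 eps0 eps_half
  (SigmaMod_le kG C gam) contrast_conc a val.
(* Adding and removing the true noise variances splits the error into that of the sample covariance
   and that of [Gamhat]. *)
have DlE : Dl = n%:R^-1 *: B + - diag_mx (\row_a (Gamhat X ne1 ne2 a a - gam (kG a))).
  have -> : diag_mx (\row_a (Gamhat X ne1 ne2 a a - gam (kG a))) =
      Gamhat X ne1 ne2 - diag_mx (\row_a gam (kG a)).
    apply/matrixP => a b; rewrite !mxE; have [->|] := eqVneq a b; last by rewrite !mulr0n subr0.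
    by rewrite !mulr1n eqxx mulr1n.
  rewrite /Dl /Sighat /B scalerBr scalerA mulVf ?gt_eqF// scale1r /Sg /SigmaMod -/A.
  by rewrite !opprD opprK !addrA [RHS]addrAC subrK [RHS]addrAC.
have Dlb x y : `|bil Dl x y| <= D * k0 * s * (vnorm x * vnorm y).
  rewrite DlE bil_addmx bil_oppmx bil_scalemx; apply: le_trans (ler_normB _ _) _.
  have v0 : 0 <= vnorm x * vnorm y by rewrite mulr_ge0 ?vnorm_ge0.
  have h1 : `|n%:R^-1 * bil B x y| <= 20000 * kap * s * (vnorm x * vnorm y).
    rewrite normrM ger0_norm ?invr_ge0 ?ler0n// ler_pdivrMl// (mulrA n%:R).
    apply: le_trans (abs_bil_le_opnorm _ _ _) _.
    by rewrite ler_wpM2r// sample_cov_opnorm.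
  have t0 : 0 <= 10 * (28 * kap) * s by rewrite !mulr_ge0 ?(ltW kap0) ?(ltW s0).
  have h2 := @abs_bil_diag_le R p (\row_a (Gamhat X ne1 ne2 a a - gam (kG a))) _ x y t0.
  have {}h2 := h2 (fun a => ltac:(rewrite mxE; exact: Gh)).
  apply: le_trans (lerD h1 h2) _; rewrite -mulrDl ler_wpM2r// DE.
  have := ler_wpM2r (ltW s0) kk0; have := mulr_gt0 k00 s0; lra.
have Kp : (K <= p)%N by rewrite pE leq_pmulr.
have topU : top_eigvecs (A *m C *m A^T + Dl) U by rewrite /Dl addrC subrK.
have DK := davis_kahan m0 groups CL Dlb l0 gap Kp topU.
have UU := top_eigvecs_orthonormal Kp topU.
apply: (kmeans_Lbar m0 groups UU (lt_trans ltr01 eta1) rho1 km).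
apply: le_trans S_small; rewrite ler_wpM2l ?mulr_ge0 ?sqr_ge0//.
Qed.

End Recovery.

Unset Implicit Arguments. Set Strict Implicit. Set Printing Implicit Defensive.

Theorem mainTheorem17 (R : realType) :
  exists c1 c2 : R, 0 < c1 /\ 0 < c2 /\
  forall eta : R, 1 < eta ->
  exists c' : R, 0 < c' /\
  forall (K m p n : nat) (kG : 'I_p -> 'I_K) (C : 'M[R]_K) (gam : 'I_K -> R)
    (rho : R) (d : measure_display) (T : measurableType d) (P : probability T R)
    (Z : 'I_n -> 'I_K -> T -> R) (E : 'I_n -> 'I_p -> T -> R),
    (0 < K)%N -> (3 <= m)%N -> p = (K * m)%N -> (0 < n)%N ->
    (forall k : 'I_K, #|[pred a | kG a == k]| = m) ->
    posdef C -> (forall k, 0 < gam k) ->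
    (forall i, centered_gaussian P (Z i) (fun k l => C k l)) ->
    (forall i, centered_gaussian P (E i) (fun a b => (a == b)%:R * gam (kG a))) ->
    mutually_indep P (fun ib : 'I_n * bool =>
      if ib.2 then sigma_of (Z ib.1) else sigma_of (E ib.1)) ->
    0 < rho < 1 ->
    c' * Num.sqrt (K%:R) * opnorm (SigmaMod kG C gam) / (m%:R * Num.sqrt rho)
      * Num.sqrt (Num.max (effrank (SigmaMod kG C gam)) (ln (p%:R)) / n%:R)
      <= lambda_min C ->
    exists A : set T, [/\ measurable A,
      A `<=` [set w | forall lab : 'I_p -> 'I_K,
                CSC_output eta (data_matrix kG Z E w) lab -> @Lbar R _ _ m lab kG <= rho] &
      ((1 - c2 / p%:R)%:E <= P A)%E].
Proof.
exists 1, 2; split => //; split => // eta eta1.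
(* K-means asks [4 * (1 + sqrt eta) ^+ 2 * K * (2 * delta / (m * lambda)) ^+ 2 <= rho], that is [m *
   lambda >= 4 * (1 + sqrt eta) * sqrt K * delta / sqrt rho], with
   [delta = 42 * 1000 * k0 * opnorm Sigma]. *)
exists (4 * (42 * 1000) * (1 + Num.sqrt eta)); split.
  by rewrite !mulr_gt0 ?ltr0n// ltr_pwDl ?sqrtr_ge0.
move=> K m p n kG C gam rho d T P Z E K0 m3 pE n0 groups Cpos gam0 gZ gE ind rho01 Hl.
have m0 : (0 < m)%N by apply: leq_trans m3.
have p3 : (3 <= p)%N by rewrite pE (leq_trans m3)// leq_pmull.
have p0 : (0 < p)%N by apply: leq_trans p3.
set L := Num.max _ _ in Hl; set k0 := Num.sqrt (L / n%:R) in Hl.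
have lnp : ln p%:R <= L by rewrite /L le_max lexx orbT.
have L23 : 2 / 3 <= L by apply: le_trans lnp; exact: ln_ge.
(* An integer above [L]; since [L >= 2 / 3], it is at most [L + 1 <= 4 * L], which gives
   [kap <= 2 * k0]. *)
pose N := (Num.truncn L).+1.
have L0 : 0 <= L by lra.
have /andP[N1 N2] := truncn_itv L0.
have LN : L <= N%:R by rewrite ltW.
have NL : N%:R <= 4 * L by rewrite /N -addn1 natrD; move: N1 L23; lra.
have nR0 : 0 < n%:R :> R by rewrite ltr0n.
have k00 : 0 < k0 by rewrite sqrtr_gt0 divr_gt0//; lra.
pose kap : R := Num.sqrt (N%:R / n%:R).
have kk0 : kap <= 2 * k0.
  have -> : 2 * k0 = Num.sqrt (4 * (L / n%:R)).
    by rewrite sqrtrM// (_ : 4 = 2 ^+ 2) ?sqrtr_sqr ?ger0_norm//; ring.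
  by rewrite ler_wsqrtr// mulrA ler_pM2r ?invr_gt0.
have /andP[rho0 rho1] := rho01.
(* The assumption on [lambda_min C] and [m * lambda_min C <= opnorm Sigma] give
   [4 * (42 * 1000) * k0 <= 1], far more than is asked. *)
have kap64 : kap <= 64^-1.
  have [D [D0 DE]] : exists D : R, 0 < D /\ D = 42 * 1000.
    by exists (42 * 1000); rewrite mulr_gt0 ?ltr0n.
  have K1 : 1 <= Num.sqrt K%:R :> R by rewrite -[leLHS]sqrtr1 ler_wsqrtr// ler1n.
  have r0 : 0 < Num.sqrt rho by rewrite sqrtr_gt0.
  have r1 : Num.sqrt rho <= 1 by rewrite -[leRHS]sqrtr1 ler_wsqrtr// ltW.
  have mR : 0 < m%:R :> R by rewrite ltr0n.
  have Ml := lambda_min_opnorm gam0 K0 m0 groups (lambda_min_le Cpos.1).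
  have Hl' := Hl; rewrite -DE in Hl'.
  have [_ h _ _] := recovery_constants D0 k00 (opnorm_SigmaMod_gt0 kG Cpos gam0 p0)
    K1 r0 r1 mR (sqrtr_ge0 eta) Hl' Ml.
  by rewrite DE in h; lra.
have N0 : (0 < N)%N by [].
have [A [mA HA PA]] := good_event Cpos gam0 n0 p0 N0 (le_trans lnp LN) kap64 gZ gE ind.
exists A; split => // w Aw lab.
have [E1 E2] := HA w Aw.
have eN : effrank (SigmaMod kG C gam) <= N%:R.
  by apply: le_trans LN; rewrite /L le_max lexx.
exact: (CSC_Lbar K0 m3 pE n0 N0 Cpos gam0 groups eN kap64 E1 E2 eta1 rho01 k00 kk0 Hl).
Qed.
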